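(* Let $A$ be a non zero self-adjoint matrix in $M_n(\mathbb{C})$, and consider the programs $(\mathcal{P})$ and $(\mathcal{P}^* )$ associated with $A$ (defined in the context). (1) The optimal value for the programs $(\mathcal{P})$ and $(\mathcal{P}^* )$ is $\|A\|_{\mathcal{S}^*}$, and an optimal solution to $(\mathcal{P})$ may be read out of the unique cbB-factorization of $A$. (2) Let $Y$ be a self-adjoint matrix in $M_n(\mathbb{C})$ such that $\|Y\|_S=1$ and $\mathrm{Tr}_n(YA)=\|A\|_{\mathcal{S}^*}$. Then a finite optimal solution for $(\mathcal{P}^* )$ may be obtained from any decomposition $Y=Q-R$ with $Q$ and $R$ positive such that $\|Y\|_S=\|Q+R\|_S$. (3) Let $\big((\mu_\xi)_{\xi\in\mathcal{S}},(\nu_\eta)_{\eta\in\mathcal{S}}\big)$ be a finite optimal solution to $(\mathcal{P}^* )$, and let $Y$ be defined by $$Y:=\sum_{\xi\in\mathcal{S}}\mu_\xi P_\xi-\sum_{\eta\in\mathcal{S}}\nu_\eta P_\eta .$$ Then $\|Y\|_S=1$ and $\mathrm{Tr}_n(YA)=\|A\|_{\mathcal{S}^*}$.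
   Context: Norms: $\|\cdot\|_\infty$ on $M_n(\mathbb{C})$ is the operator norm; $(X\circ Y)_{(i,j)}=X_{(i,j)}Y_{(i,j)}$ is the Schur product; $\|X\|_S=\sup\{\|X\circ Y\|_\infty : Y\in M_n(\mathbb{C}),\ \|Y\|_\infty\le 1\}$ is the Schur multiplier norm; $\|X\|_{\mathcal{S}^*}=\sup\{|\mathrm{Tr}_n(Y^*X)| : Y\in M_n(\mathbb{C}),\ \|Y\|_S\le 1\}$ is its dual norm, with $\mathrm{Tr}_n$ the (unnormalized) trace. $\Delta(\lambda)$ is the diagonal matrix with diagonal entries from the vector $\lambda$. ''Positive'' means positive semidefinite. Decompositions: for every self-adjoint $Y\in M_n(\mathbb{C})$ one has $\|Y\|_S=\min\{\|Q+R\|_S : Q,R\in M_n(\mathbb{C}) \text{ positive},\ Y=Q-R\}$, so decompositions as in (2) exist. cbB-factorization: for a non zero self-adjoint $A$ there are a unit vector $\xi\in\mathbb{R}^n$ with non negative entries and a self-adjoint $B\in M_n(\mathbb{C})$ with $A=\Delta(\xi)B\Delta(\xi)$ and $\|B\|_\infty=\|A\|_{\mathcal{S}^*}$; the vector $\xi$ is uniquely determined, and $B$ is uniquely determined if the kernels of $B$ and of $B^*$ are required to contain the kernel of $\Delta(\xi)$. This is called the unique cbB-factorization of $A$. Programs: let $\mathcal{S}$ (as an index set) denote the set of unit vectors in $\mathbb{C}^n$ with its Euclidean norm and inner product $\langle\cdot,\cdot\rangle$. For $\xi\in\mathcal{S}$, $P_\xi$ denotes the matrix of the orthogonal projection onto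 $\mathbb{C}\xi$. $(\mathcal{P})$: minimize $\sum_{j=1}^n\lambda_j$ over $\lambda\in\mathbb{R}^n$ subject to $\lambda_j\ge0$ for all $j$, $\sum_{j=1}^n\lambda_j|\xi_j|^2\ge\langle A\xi,\xi\rangle$ for all $\xi\in\mathcal{S}$, and $\sum_{j=1}^n\lambda_j|\eta_j|^2\ge-\langle A\eta,\eta\rangle$ for all $\eta\in\mathcal{S}$. $(\mathcal{P}^* )$: maximize $\sum_{\xi\in\mathcal{S}}\mu_\xi\langle A\xi,\xi\rangle-\sum_{\eta\in\mathcal{S}}\nu_\eta\langle A\eta,\eta\rangle$ over families of real numbers $\big((\mu_\xi)_{\xi\in\mathcal{S}},(\nu_\eta)_{\eta\in\mathcal{S}}\big)$ subject to $\mu_\xi\ge0$ for all $\xi\in\mathcal{S}$, $\nu_\eta\ge0$ for all $\eta\in\mathcal{S}$, and $\sum_{\xi\in\mathcal{S}}\mu_\xi|\xi_j|^2+\sum_{\eta\in\mathcal{S}}\nu_\eta|\eta_j|^2\le1$ for all $j\in\{1,\dots,n\}$. (For families satisfying these constraints both sums in the objective converge absolutely.) A vector or family of variables is called a solution; a feasible solution is one satisfying all constraints; an optimal solution is a feasible solution attaining the optimal (minimal, respectively maximal) value; a finite solution is one with only finitely many non vanishing variables. *)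

(* Defs.v *)
From HB Require Import structures.
From mathcomp Require Import all_boot all_order all_algebra.
From mathcomp Require Import all_classical all_reals all_analysis.
From mathcomp Require Import complex.

Set Implicit Arguments.
Unset Strict Implicit.
Unset Printing Implicit Defensive.

Import Order.TTheory GRing.Theory Num.Theory.

Local Open Scope classical_set_scope.
Local Open Scope ring_scope.
Local Open Scope complex_scope.
Local Open Scope sesquilinear_scope.

Section Norms.
Context {R : realType} {n : nat}.
Local Notation C := R[i].
Implicit Types (X Y Q : 'M[C]_n) (u v : 'cV[C]_n).

(* The real-valued modulus: `|z| has type C, with zero imaginary part. *)
Definition cabs (z : C) : R := complex.Re `|z|.

(* Linear in the first argument. *)
Definition cdot u v : C := \sum_(j < n) u j 0 * ((v j 0)^*)%R.

Definition l2norm v : R := Num.sqrt (\sum_(j < n) cabs (v j 0) ^+ 2).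

(* All suprema below are over nonempty sets, bounded because n is finite. *)
Definition opnorm X : R :=
  sup [set l2norm (X *m v) | v in [set v | l2norm v <= 1]].

Definition schur X Y : 'M[C]_n := map2_mx *%R X Y.

Definition schur_norm X : R :=
  sup [set opnorm (schur X Y) | Y in [set Y | opnorm Y <= 1]].

Definition schur_dual_norm X : R :=
  sup [set cabs (\tr (Y^t* *m X)) | Y in [set Y | schur_norm Y <= 1]].

(* The order of C makes 0 <= z mean that z is real and nonnegative. *)
Definition psd Q : Prop := forall v, 0 <= cdot (Q *m v) v.

Definition Delta (d : 'rV[R]_n) : 'M[C]_n := diag_mx (map_mx (real_complex R) d).

Definition usphere : set 'cV[C]_n := [set xi | l2norm xi = 1].

(* For a unit vector xi, the matrix of v |-> <v, xi> xi. *)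
Definition proj (xi : 'cV[C]_n) : 'M[C]_n := xi *m xi^t*.

End Norms.

Section Factorization.
Context {R : realType} {n : nat}.
Local Notation C := R[i].

Definition cbB_factorization (A : 'M[C]_n) (xi : 'rV[R]_n) (B : 'M[C]_n) :
    Prop :=
  [/\ \sum_(j < n) xi 0 j ^+ 2 = 1 /\ (forall j, 0 <= xi 0 j),
      B \is hermsymmx,
      A = Delta xi *m B *m Delta xi,
      opnorm B = schur_dual_norm A
    & forall v : 'cV[C]_n, Delta xi *m v = 0 -> B *m v = 0 /\ B^t* *m v = 0].

End Factorization.

Section Programs.
Context {R : realType} {n : nat}.
Local Notation C := R[i].
Implicit Types (A : 'M[C]_n) (l : 'rV[R]_n) (mu nu : 'cV[C]_n -> R).

(* <A xi, xi>, which is real for self-adjoint A. *)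
Definition qform A (xi : 'cV[C]_n) : R := complex.Re (cdot (A *m xi) xi).

Definition primal_feasible A l : Prop :=
  [/\ forall j, 0 <= l 0 j,
      forall xi, usphere xi ->
        qform A xi <= \sum_(j < n) l 0 j * cabs (xi j 0) ^+ 2
    & forall eta, usphere eta ->
        - qform A eta <= \sum_(j < n) l 0 j * cabs (eta j 0) ^+ 2].

Definition primal_obj l : R := \sum_(j < n) l 0 j.

Definition primal_optimal A l : Prop :=
  primal_feasible A l /\
  forall l', primal_feasible A l' -> primal_obj l <= primal_obj l'.

Definition primal_value A (c : R) : Prop :=
  exists2 l, primal_optimal A l & primal_obj l = c.

(* A family indexed by the unit sphere is given by a function on all vectors;
   only its restriction to [usphere] is ever used. *)
Definition dual_feasible mu nu : Prop :=
  [/\ forall xi, usphere xi -> 0 <= mu xi,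
      forall eta, usphere eta -> 0 <= nu eta
    & forall j : 'I_n,
        (\esum_(xi in usphere) (mu xi * cabs (xi j 0) ^+ 2)%:E +
         \esum_(eta in usphere) (nu eta * cabs (eta j 0) ^+ 2)%:E <= 1)%E].

(* The sum of an absolutely summable real family over a possibly uncountable
   set ([esum] is only meaningful for nonnegative terms). *)
Definition rsum (T : choiceType) (S : set T) (f : T -> R) : R :=
  fine (\esum_(x in S) (Num.max (f x) 0)%:E)
  - fine (\esum_(x in S) (Num.max (- f x) 0)%:E).

Definition dual_obj A mu nu : R :=
  rsum usphere (fun xi => mu xi * qform A xi)
  - rsum usphere (fun eta => nu eta * qform A eta).

Definition dual_optimal A mu nu : Prop :=
  dual_feasible mu nu /\
  forall mu' nu', dual_feasible mu' nu' ->
    dual_obj A mu' nu' <= dual_obj A mu nu.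

Definition dual_value A (c : R) : Prop :=
  exists mu nu, dual_optimal A mu nu /\ dual_obj A mu nu = c.

Definition finite_family mu nu : Prop :=
  finite_set [set xi | usphere xi /\ mu xi != 0] /\
  finite_set [set eta | usphere eta /\ nu eta != 0].

(* For a finite family, sum over the unit sphere of mu_xi P_xi. *)
Definition proj_sum mu : 'M[C]_n :=
  \sum_(xi \in usphere) (mu xi)%:C *: proj xi.

End Programs.

(* Main.v *)
Require Import Defs.
From HB Require Import structures.
From mathcomp Require Import all_boot all_order all_algebra.
From mathcomp Require Import all_classical all_reals all_analysis.
From mathcomp Require Import complex ring lra.

(** Write [N] for the dual Schur norm of [A]. The primal program minimises the
trace of a diagonal matrix [D] with [- D <= A <= D]. Grouping the weights of a
dual family into the positive matrices [Q] (the sum of the mu-weighted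
projections) and [S] (the same for nu), the dual program maximises the trace of
[(Q - S) A] over positive [Q] and [S] such that [Q + S] has diagonal at most 1.
The theorem says that [N] is the common value of this pair of semidefinite
programs, and three facts give it.

The primal value is at least [N]. If [- D <= A <= D], a Cauchy-Schwarz argument
shows that dividing [A] on both sides by the square root of [D] leaves a
self-adjoint contraction [B] ([feasible_factorization]). Then the pairing of [A]
with a Schur multiplier [Y] is a value of the form of the Schur product of [Y]
and the conjugate of [B] at the vector of square roots of the diagonal of [D],
hence at most the Schur norm of [Y] times the trace of [D] ([feasible_trace]).

The dual value is at most [N]. If [Q] and [S] are feasible, writing them as sums
of rank one matrices shows that [Q - S] has Schur norm at most 1
([pair_schur_norm]).

There is no duality gap ([duality_alternative]). For a threshold [c], the sum of
the squared violations of the constraints and of the squared shortfall of the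
objective below [c] has a minimum over all pairs of positive matrices. If the
minimum is 0, a feasible pair reaches [c]. Otherwise the violations at the
minimum are Lagrange multipliers, and normalising them gives a primal feasible
vector of sum below [c]. Taking [c] to be [N], where the second case contradicts
the first fact, gives an optimal dual pair, and taking [c] above [N] gives
almost optimal primal vectors, whence an optimal one by compactness.

The statements on optimal solutions follow. The factorisation of [A] by an
optimal primal vector is a cbB-factorisation, and conversely the squares of any
cbB-vector times [N] are feasible with sum [N]. If [Y = Q - S] is norming and
[Q + S] has Schur norm 1, its diagonal is at most 1, so the spectral
decompositions of [Q] and [S] are an optimal family. Finally a finite optimal
family sums to a norming [Y] whose Schur norm is at most 1 by the second fact
and at least 1 by the first. Infinite families are compared with a primal
optimum by [weak_duality]. *)

Set Implicit Arguments.
Unset Strict Implicit.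
Unset Printing Implicit Defensive.

Import Order.TTheory GRing.Theory Num.Theory.
Import numFieldNormedType.Exports.

Local Open Scope classical_set_scope.
Local Open Scope ring_scope.
Local Open Scope complex_scope.
Local Open Scope sesquilinear_scope.

(** * Complex scalars and Young's inequality *)

Section Scalars.
Context {R : realType}.
Local Notation C := R[i].
Local Notation Re := (@complex.Re R).
Local Notation Im := (@complex.Im R).
Implicit Types (z w : C) (x y p q t : R).

Lemma ReD z w : Re (z + w) = Re z + Re w.
Proof. by case: z w => [a b] []. Qed.

Lemma ReN z : Re (- z) = - Re z.
Proof. by case: z. Qed.

Lemma ReB z w : Re (z - w) = Re z - Re w.
Proof. by rewrite ReD ReN. Qed.

Lemma Re_sum (I : Type) (r : seq I) (P : pred I) (F : I -> C) :
  Re (\sum_(i <- r | P i) F i) = \sum_(i <- r | P i) Re (F i).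
Proof. by elim/big_rec2: _ => // i y z _ <-; rewrite ReD. Qed.

Lemma ReM z w : Re (z * w) = Re z * Re w - Im z * Im w.
Proof. by case: z w => [a b] []. Qed.

Lemma ImM z w : Im (z * w) = Re z * Im w + Im z * Re w.
Proof. by case: z w => [a b] []. Qed.

Lemma ReMr x z : Re (x%:C * z) = x * Re z.
Proof. by rewrite ReM mul0r subr0. Qed.

Lemma conjE z : (z^*)%R = (z^*)%C.
Proof. by []. Qed.

Lemma conjr x : ((x%:C)^*)%R = x%:C.
Proof. by rewrite conjE conjc_real. Qed.

Lemma Re_conj z : Re (z^*)%R = Re z.
Proof. by rewrite conjE; case: z. Qed.

Lemma Im_conj z : Im (z^*)%R = - Im z.
Proof. by rewrite conjE; case: z. Qed.

Lemma cabsE z : (cabs z)%:C = `|z|.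
Proof. by rewrite /cabs RRe_real // normr_real. Qed.

Lemma cabs_ge0 z : 0 <= cabs z.
Proof. by rewrite -ler0c cabsE. Qed.

Lemma cabsM z w : cabs (z * w) = cabs z * cabs w.
Proof. by apply: complexI; rewrite rmorphM !cabsE normrM. Qed.

Lemma cabs_conj z : cabs (z^*)%R = cabs z.
Proof. by apply: complexI; rewrite !cabsE norm_conjC. Qed.

Lemma cabsr x : cabs x%:C = `|x|.
Proof. by rewrite /cabs normc_def /= expr0n addr0 sqrtr_sqr. Qed.

Lemma cabs0 : cabs (0 : C) = 0.
Proof. by rewrite (cabsr 0) normr0. Qed.

Lemma cabs_sqr z : (cabs z ^+ 2)%:C = z * (z^*)%R.
Proof. by rewrite rmorphXn /= cabsE -normCK. Qed.

Lemma Re_sqr z : Re (z * (z^*)%R) = cabs z ^+ 2.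
Proof. by rewrite -cabs_sqr. Qed.

Lemma cabsD z w : cabs (z + w) <= cabs z + cabs w.
Proof. by rewrite -lecR rmorphD /= !cabsE ler_normD. Qed.

Lemma cabs_sum (I : Type) (r : seq I) (P : pred I) (F : I -> C) :
  cabs (\sum_(i <- r | P i) F i) <= \sum_(i <- r | P i) cabs (F i).
Proof.
elim/big_rec2: _ => [|i x z _ zx]; first by rewrite cabs0.
by apply: le_trans (cabsD _ _) _; rewrite lerD2l.
Qed.

Lemma Re_le_cabs z : Re z <= cabs z.
Proof.
by rewrite -lecR cabsE; apply: le_trans (normc_ge_Re z); rewrite lecR ler_norm.
Qed.

Lemma cabsN z : cabs (- z) = cabs z.
Proof. by apply: complexI; rewrite !cabsE normrN. Qed.

Lemma cabs_eq0 z : (cabs z == 0) = (z == 0).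
Proof. by rewrite -(inj_eq (@complexI R)) cabsE normr_eq0. Qed.

Lemma cabs_phase z : exists2 w, cabs w = 1 & Re (w * z) = cabs z.
Proof.
have [->|z0] := eqVneq z 0.
  by exists 1; rewrite ?mulr0 ?cabs0// (cabsr 1) normr1.
have c0 : cabs z != 0 by rewrite cabs_eq0.
exists ((cabs z)^-1%:C * (z^*)%R).
  rewrite cabsM cabs_conj cabsr ger0_norm ?invr_ge0 ?cabs_ge0 //.
  by rewrite mulVf.
by rewrite -mulrA ReMr mulrC (mulrC _ z) Re_sqr expr2 mulfK.
Qed.

(** Optimising the weight [t] in Young's inequality turns an additive bound
into a Cauchy-Schwarz bound; every Cauchy-Schwarz estimate below is obtained
this way. *)
Lemma young_sqrt x p q : 0 <= p -> 0 <= q ->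
  (forall t, 0 < t -> x * 2 <= t * p + t^-1 * q) ->
  x <= Num.sqrt p * Num.sqrt q.
Proof.
have deg r : 0 <= r -> (forall t, 0 < t -> x * 2 <= t * r) -> x <= 0.
  rewrite le_eqVlt => /predU1P[<- /(_ 1 ltr01)|r0 h]; first by lra.
  rewrite leNgt; apply/negP => x0; have := h (x / r) (divr_gt0 x0 r0).
  by rewrite divfK ?gt_eqF //; lra.
rewrite le_eqVlt => /predU1P[<- q0 h|p0].
  rewrite sqrtr0 mul0r; apply: (deg q) => // t t0.
  by have := h t^-1; rewrite invrK mulr0 add0r invr_gt0; apply.
rewrite le_eqVlt => /predU1P[<- h|q0 h].
  rewrite sqrtr0 mulr0; apply: (deg p (ltW p0)) => t t0.
  by have := h t t0; rewrite mulr0 addr0.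
have sp : 0 < Num.sqrt p by rewrite sqrtr_gt0.
have sq : 0 < Num.sqrt q by rewrite sqrtr_gt0.
have := h (Num.sqrt q / Num.sqrt p) (divr_gt0 sq sp).
rewrite -{2}(sqr_sqrtr (ltW p0)) -{3}(sqr_sqrtr (ltW q0)).
have -> : Num.sqrt q / Num.sqrt p * Num.sqrt p ^+ 2
   + (Num.sqrt q / Num.sqrt p)^-1 * Num.sqrt q ^+ 2
   = Num.sqrt p * Num.sqrt q * 2.
  by field; rewrite ?gt_eqF.
by lra.
Qed.

Lemma young (a b : R) t : 0 < t -> a * b * 2 <= t * a ^+ 2 + t^-1 * b ^+ 2.
Proof.
move=> t0; rewrite -subr_ge0.
have -> : t * a ^+ 2 + t^-1 * b ^+ 2 - a * b * 2 = t^-1 * (t * a - b) ^+ 2.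
  by field; rewrite gt_eqF.
by rewrite mulr_ge0 ?sqr_ge0 // invr_ge0 ltW.
Qed.

Lemma cauchy_schwarz_sum (I : finType) (a b : I -> R) :
  \sum_i a i * b i
  <= Num.sqrt (\sum_i a i ^+ 2) * Num.sqrt (\sum_i b i ^+ 2).
Proof.
apply: young_sqrt => [||t t0]; try by apply: sumr_ge0 => i _; apply: sqr_ge0.
rewrite mulr_suml !mulr_sumr -big_split /=.
by apply: ler_sum => i _; apply: young.
Qed.

End Scalars.

(** * Operator norm, Schur multiplier norm and its dual *)

Section Vectors.
Context {R : realType} {n : nat}.
Local Notation C := R[i].
Local Notation Re := (@complex.Re R).
Implicit Types (u v w : 'cV[C]_n) (X Y : 'M[C]_n) (a : C) (c x : R).

Lemma l2norm_ge0 v : 0 <= l2norm v.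
Proof. exact: sqrtr_ge0. Qed.

Lemma l2norm_sqr v : l2norm v ^+ 2 = \sum_j cabs (v j 0) ^+ 2.
Proof. by rewrite sqr_sqrtr // sumr_ge0 // => j _; apply: sqr_ge0. Qed.

Lemma l2norm0 : l2norm (0 : 'cV[C]_n) = 0.
Proof.
by rewrite /l2norm big1 ?sqrtr0 // => j _; rewrite mxE cabs0 expr0n.
Qed.

Lemma cabs_coord v j : cabs (v j 0) <= l2norm v.
Proof.
rewrite -ler_sqr ?nnegrE ?cabs_ge0 ?l2norm_ge0 // l2norm_sqr (bigD1 j) //=.
by rewrite lerDl sumr_ge0 // => k _; apply: sqr_ge0.
Qed.

Lemma l2norm_eq0 v : l2norm v = 0 -> v = 0.
Proof.
move=> v0; apply/matrixP => j k; rewrite ord1 mxE; apply/eqP.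
by rewrite -cabs_eq0 eq_le cabs_ge0 andbT -v0 cabs_coord.
Qed.

Lemma l2normZ a v : l2norm (a *: v) = cabs a * l2norm v.
Proof.
rewrite -[cabs a]ger0_norm ?cabs_ge0 // -sqrtr_sqr -sqrtrM ?sqr_ge0 //.
congr Num.sqrt; rewrite mulr_sumr; apply: eq_bigr => j _.
by rewrite mxE cabsM exprMn.
Qed.

Lemma l2norm_delta (j : 'I_n) : l2norm (delta_mx j 0 : 'cV[C]_n) = 1.
Proof.
rewrite /l2norm (bigD1 j) //= big1 => [|k kj].
  by rewrite mxE !eqxx (cabsr 1) normr1 expr1n addr0 sqrtr1.
by rewrite mxE (negPf kj) cabs0 expr0n.
Qed.

Lemma cdotE u v : cdot u v = (v^t* *m u) 0 0.
Proof. by rewrite mxE; apply: eq_bigr => j _; rewrite !mxE mulrC. Qed.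

Lemma cdotDl u v w : cdot (u + v) w = cdot u w + cdot v w.
Proof. by rewrite !cdotE mulmxDr mxE. Qed.

Lemma cdotNl u w : cdot (- u) w = - cdot u w.
Proof. by rewrite !cdotE mulmxN mxE. Qed.

Lemma cdotZl a u v : cdot (a *: u) v = a * cdot u v.
Proof. by rewrite !cdotE -scalemxAr mxE. Qed.

Lemma cdot_conj u v : ((cdot u v)^*)%R = cdot v u.
Proof.
by rewrite /cdot rmorph_sum /=; apply: eq_bigr => j _; rewrite rmorphM /= conjCK mulrC.
Qed.

Lemma cdotDr u v w : cdot u (v + w) = cdot u v + cdot u w.
Proof. by rewrite -cdot_conj cdotDl rmorphD /= !cdot_conj. Qed.

Lemma cdotNr u w : cdot u (- w) = - cdot u w.
Proof. by rewrite -cdot_conj cdotNl rmorphN /= cdot_conj. Qed.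

Lemma cdotZr a u v : cdot u (a *: v) = (a^*)%R * cdot u v.
Proof. by rewrite -cdot_conj cdotZl rmorphM /= cdot_conj. Qed.

Lemma cdot_delta X i j : cdot (X *m delta_mx j 0) (delta_mx i 0) = X i j.
Proof.
rewrite cdotE mulmxA -[_ *m delta_mx _ _]colE mxE.
rewrite (_ : _^t* = delta_mx 0 i) -?rowE ?mxE //.
apply/matrixP => k l; rewrite !mxE andbC.
by case: (_ && _); rewrite ?rmorph1 ?rmorph0.
Qed.

Lemma Re_cdotvv v : Re (cdot v v) = l2norm v ^+ 2.
Proof. by rewrite l2norm_sqr Re_sum; apply: eq_bigr => j _; rewrite Re_sqr. Qed.

Lemma cdot_cs u v : cabs (cdot u v) <= l2norm u * l2norm v.
Proof.
apply: le_trans (cauchy_schwarz_sum _ _); apply: le_trans (cabs_sum _ _ _) _.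
by apply: ler_sum => j _; rewrite cabsM cabs_conj.
Qed.

Lemma l2norm_le u c : 0 <= c ->
  (forall w, Re (cdot u w) <= c * l2norm w) -> l2norm u <= c.
Proof.
move=> c0 /(_ u); rewrite Re_cdotvv expr2.
have [->//|u0] := eqVneq (l2norm u) 0.
by rewrite ler_pM2r // lt_neqAle eq_sym u0 l2norm_ge0.
Qed.

Lemma cdot_entries X u v :
  cdot (X *m u) v = \sum_i \sum_j X i j * u j 0 * ((v i 0)^*)%R.
Proof.
by apply: eq_bigr => i _; rewrite mxE mulr_suml.
Qed.

Lemma cdot_entry_sum X u v :
  Re (cdot (X *m u) v) <= (\sum_i \sum_j cabs (X i j)) * l2norm u * l2norm v.
Proof.
apply: le_trans (Re_le_cabs _) _; rewrite cdot_entries.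
apply: le_trans (cabs_sum _ _ _) _; rewrite !mulr_suml; apply: ler_sum => i _.
apply: le_trans (cabs_sum _ _ _) _; rewrite !mulr_suml; apply: ler_sum => j _.
rewrite !cabsM cabs_conj.
by rewrite !ler_pM ?mulr_ge0 ?cabs_ge0 ?cabs_coord.
Qed.

Lemma entry_sum_ge0 X : 0 <= \sum_i \sum_j cabs (X i j).
Proof. by do 2![apply: sumr_ge0 => ? _]; apply: cabs_ge0. Qed.

Lemma l2norm_mul_le X c : 0 <= c ->
  (forall u v, Re (cdot (X *m u) v) <= c * l2norm u * l2norm v) ->
  forall v, l2norm (X *m v) <= c * l2norm v.
Proof. by move=> c0 h v; apply: l2norm_le; rewrite ?mulr_ge0 ?l2norm_ge0. Qed.

Lemma opnorm_has_sup X :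
  has_sup [set l2norm (X *m v) | v in [set v : 'cV[C]_n | l2norm v <= 1]].
Proof.
split; first by exists (l2norm (X *m 0)), 0 => //=; rewrite l2norm0.
exists (\sum_i \sum_j cabs (X i j)) => _ [v /= v1 <-].
apply: le_trans (l2norm_mul_le (entry_sum_ge0 X) (cdot_entry_sum X) v) _.
by rewrite ler_piMr ?entry_sum_ge0.
Qed.

Lemma opnorm_le X c : 0 <= c ->
  (forall u v, Re (cdot (X *m u) v) <= c * l2norm u * l2norm v) ->
  opnorm X <= c.
Proof.
move=> c0 h; apply: ge_sup; first by case: (opnorm_has_sup X).
move=> _ [v /= v1 <-].
by apply: le_trans (l2norm_mul_le c0 h v) _; rewrite ler_piMr.
Qed.

Lemma opnorm_ge0 X : 0 <= opnorm X.
Proof.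
apply: (le_trans (l2norm_ge0 (X *m 0))); apply: ub_le_sup.
  by case: (opnorm_has_sup X).
by exists 0 => //=; rewrite l2norm0.
Qed.

Lemma opnorm_ub X v : l2norm (X *m v) <= opnorm X * l2norm v.
Proof.
have [v0|v0] := eqVneq (l2norm v) 0.
  by rewrite v0 (l2norm_eq0 v0) mulmx0 l2norm0 mulr0.
have lv : 0 < l2norm v by rewrite lt_neqAle eq_sym v0 l2norm_ge0.
rewrite -ler_pdivrMr // mulrC.
have inv : cabs ((l2norm v)^-1%:C) = (l2norm v)^-1.
  by rewrite cabsr ger0_norm ?invr_ge0 ?ltW.
rewrite -inv -l2normZ scalemxAr; apply: ub_le_sup.
  by case: (opnorm_has_sup X).
by exists ((l2norm v)^-1%:C *: v) => //=; rewrite l2normZ inv mulVf.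
Qed.

Lemma opnorm_cdot X u v :
  cabs (cdot (X *m u) v) <= opnorm X * l2norm u * l2norm v.
Proof.
apply: le_trans (cdot_cs _ _) _.
by rewrite ler_pM ?l2norm_ge0 ?opnorm_ub.
Qed.

Lemma cabs_entry_opnorm X i j : cabs (X i j) <= opnorm X.
Proof.
rewrite -cdot_delta; apply: le_trans (opnorm_cdot _ _ _) _.
by rewrite !l2norm_delta !mulr1.
Qed.

Lemma opnorm_le_entries X : opnorm X <= \sum_i \sum_j cabs (X i j).
Proof. by apply: opnorm_le (cdot_entry_sum X); apply: entry_sum_ge0. Qed.

Lemma opnorm_delta_le1 (i j : 'I_n) : opnorm (delta_mx i j : 'M[C]_n) <= 1.
Proof.
apply: le_trans (opnorm_le_entries _) _.
rewrite (bigD1 i) //= (bigD1 j) //= !big1 ?addr0 => [|k ki|k kj].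
- by rewrite mxE !eqxx (cabsr 1) normr1.
- by rewrite big1 // => l _; rewrite mxE (negPf ki) cabs0.
- by rewrite mxE eqxx (negPf kj) cabs0.
Qed.

Lemma l2norm_conj v : l2norm (map_mx Num.conj v) = l2norm v.
Proof. by congr Num.sqrt; apply: eq_bigr => j _; rewrite mxE cabs_conj. Qed.

(** The trace pairing conjugates one of its arguments, so a factor of [A] reaches
the Schur multiplier norm only through its entrywise conjugate. *)
Lemma opnorm_conj X : opnorm (map_mx Num.conj X) <= opnorm X.
Proof.
apply: opnorm_le (opnorm_ge0 X) _ => u v; apply: le_trans (Re_le_cabs _) _.
rewrite -(l2norm_conj u) -(l2norm_conj v).
apply: le_trans _ (opnorm_cdot _ _ _); rewrite -[leRHS]cabs_conj.
rewrite !cdot_entries rmorph_sum le_eqVlt; apply/predU1P; left; congr cabs.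
apply: eq_bigr => i _; rewrite rmorph_sum; apply: eq_bigr => j _.
by rewrite !mxE !rmorphM /= !conjCK.
Qed.

Lemma schur_norm_has_sup X :
  has_sup [set opnorm (schur X Y) | Y in [set Y : 'M[C]_n | opnorm Y <= 1]].
Proof.
have o0 : opnorm (0 : 'M[C]_n) <= 1.
  by apply: opnorm_le => // u v; rewrite mul0mx cdotE mulmx0 mxE !mulr_ge0 ?l2norm_ge0.
split; first by exists (opnorm (schur X 0)), 0.
exists (\sum_i \sum_j cabs (X i j)) => _ [Y /= Y1 <-].
apply: le_trans (opnorm_le_entries _) _; do 2![apply: ler_sum => ? _].
rewrite mxE cabsM ler_piMr ?cabs_ge0 //.
exact: le_trans (cabs_entry_opnorm _ _ _) Y1.
Qed.

Lemma schur_norm_le X c :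
  (forall Y, opnorm Y <= 1 -> opnorm (schur X Y) <= c) -> schur_norm X <= c.
Proof.
move=> h; apply: ge_sup; first by case: (schur_norm_has_sup X).
by move=> _ [Y /= Y1 <-]; apply: h.
Qed.

Lemma schur_norm_ub1 X Y : opnorm Y <= 1 -> opnorm (schur X Y) <= schur_norm X.
Proof.
by move=> Y1; apply: ub_le_sup; [case: (schur_norm_has_sup X)|exists Y].
Qed.

(** Testing on matrix units bounds every entry of a Schur multiplier. Hence the
dual norm is finite, and the diagonal of [Q + S] is controlled in terms of the
Schur norm. *)
Lemma cabs_entry_schur X i j : cabs (X i j) <= schur_norm X.
Proof.
apply: le_trans _ (schur_norm_ub1 X (opnorm_delta_le1 i j)).
by apply: le_trans _ (cabs_entry_opnorm _ i j); rewrite !mxE !eqxx mulr1.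
Qed.

(** The bound [c] is kept apart from [opnorm Y] so that rescaling never divides
by the norm of a zero matrix. *)
Lemma schur_norm_ub X Y c : 0 < c -> opnorm Y <= c ->
  opnorm (schur X Y) <= schur_norm X * c.
Proof.
move=> c0 Yc; pose Z := c^-1%:C *: Y.
have ci : cabs (c^-1%:C : C) = c^-1 by rewrite cabsr gtr0_norm ?invr_gt0.
have Z1 : opnorm Z <= 1.
  apply: opnorm_le => // u v; apply: le_trans (Re_le_cabs _) _.
  rewrite -scalemxAl cdotZl cabsM ci -mulrA ler_pdivrMl //.
  apply: le_trans (opnorm_cdot _ _ _) _.
  by rewrite -mulrA mul1r ler_wpM2r ?mulr_ge0 ?l2norm_ge0.
have YZ : schur X Y = c%:C *: schur X Z.
  apply/matrixP => i j; rewrite !mxE mulrCA; congr (_ * _).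
  by rewrite mulrA -rmorphM /= mulfV ?gt_eqF // mul1r.
have sZ := schur_norm_ub1 X Z1.
have s0 := le_trans (opnorm_ge0 _) sZ.
rewrite mulrC; apply: opnorm_le => [|u v]; first by rewrite mulr_ge0 // ltW.
apply: le_trans (Re_le_cabs _) _.
rewrite YZ -scalemxAl cdotZl cabsM cabsr gtr0_norm //.
rewrite -!mulrA ler_pM2l // mulrA; apply: le_trans (opnorm_cdot _ _ _) _.
by rewrite -!mulrA ler_wpM2r ?mulr_ge0 ?l2norm_ge0.
Qed.

Lemma schur_dual_norm_has_sup X :
  has_sup [set cabs (\tr (Y^t* *m X)) | Y in [set Y : 'M[C]_n | schur_norm Y <= 1]].
Proof.
split.
  exists (cabs (\tr ((0 : 'M[C]_n)^t* *m X))), 0 => //=.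
  apply: schur_norm_le => Y _; apply: le_trans (opnorm_le_entries _) _.
  by rewrite big1 // => i _; rewrite big1 // => j _; rewrite !mxE mul0r cabs0.
exists (\sum_i \sum_j cabs (X j i)) => _ [Y /= Y1 <-].
apply: le_trans (cabs_sum _ _ _) _; apply: ler_sum => i _; rewrite mxE.
apply: le_trans (cabs_sum _ _ _) _; apply: ler_sum => j _.
rewrite !mxE cabsM cabs_conj ler_piMl ?cabs_ge0 //.
exact: le_trans (cabs_entry_schur _ _ _) Y1.
Qed.

Lemma schur_dual_norm_le X c :
  (forall Y, schur_norm Y <= 1 -> cabs (\tr (Y^t* *m X)) <= c) ->
  schur_dual_norm X <= c.
Proof.
move=> h; apply: ge_sup; first by case: (schur_dual_norm_has_sup X).
by move=> _ [Y /= Y1 <-]; apply: h.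
Qed.

Lemma schur_dual_norm_ub X Y :
  schur_norm Y <= 1 -> cabs (\tr (Y^t* *m X)) <= schur_dual_norm X.
Proof.
by move=> Y1; apply: ub_le_sup; [case: (schur_dual_norm_has_sup X)|exists Y].
Qed.

End Vectors.

(** * Feasible vectors and factorisations *)

Section Hermitian.
Context {R : realType} {n : nat}.
Local Notation C := R[i].
Local Notation Re := (@complex.Re R).
Implicit Types (u v w : 'cV[C]_n) (A X Y B : 'M[C]_n) (a : C) (c x t : R).
Implicit Types (l d : 'rV[R]_n).

Lemma hermsymmxE A : (A \is hermsymmx) = (A == A^t*).
Proof. by rewrite qualifE /= expr0 scale1r. Qed.

Lemma hermsymmx_eq A : A \is hermsymmx -> A^t* = A.
Proof. by rewrite hermsymmxE => /eqP <-. Qed.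

Lemma cdot_adj X u v : cdot (X *m u) v = cdot u (X^t* *m v).
Proof.
by rewrite !cdotE trmx_mul map_mxM /= trmxCK mulmxA.
Qed.

Lemma herm_cdot_sym A u v : A \is hermsymmx ->
  Re (cdot (A *m v) u) = Re (cdot (A *m u) v).
Proof. by move=> /hermsymmx_eq hA; rewrite cdot_adj hA -cdot_conj Re_conj. Qed.

Lemma qformZ A a v : qform A (a *: v) = cabs a ^+ 2 * qform A v.
Proof.
by rewrite /qform -scalemxAr cdotZl cdotZr mulrA -cabs_sqr ReMr.
Qed.

Lemma herm_polarization A u v : A \is hermsymmx ->
  Re (cdot (A *m u) v) * 4 = qform A (u + v) - qform A (u - v).
Proof.
move=> hA; rewrite /qform !mulmxDr !cdotDl !cdotDr mulmxN !cdotNr !cdotNl.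
by rewrite !(ReD, ReN) (herm_cdot_sym u v hA); lra.
Qed.

(** The quadratic form of the diagonal matrix of [l], which is the right-hand side
of the constraints of the primal program. *)
Definition wsqnorm l v : R := \sum_j l 0 j * cabs (v j 0) ^+ 2.

Lemma wsqnorm_ge0 l v : (forall j, 0 <= l 0 j) -> 0 <= wsqnorm l v.
Proof. by move=> l0; apply: sumr_ge0 => j _; rewrite mulr_ge0 ?sqr_ge0. Qed.

Lemma wsqnormZ l a v : wsqnorm l (a *: v) = cabs a ^+ 2 * wsqnorm l v.
Proof.
rewrite mulr_sumr; apply: eq_bigr => j _.
by rewrite mxE cabsM exprMn mulrCA.
Qed.

Lemma wsqnorm_delta l j : wsqnorm l (delta_mx j 0) = l 0 j.
Proof.
rewrite /wsqnorm (bigD1 j) //= big1 ?addr0 => [|k kj].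
  by rewrite mxE !eqxx (cabsr 1) normr1 expr1n mulr1.
by rewrite mxE (negPf kj) cabs0 expr0n mulr0.
Qed.

Lemma cabs_parallelogram a b :
  cabs (a + b : C) ^+ 2 + cabs (a - b) ^+ 2 = (cabs a ^+ 2 + cabs b ^+ 2) * 2.
Proof.
rewrite -!Re_sqr !rmorphD !rmorphN /= !(mulrDl, mulrDr, mulrN, mulNr) !(ReD, ReN).
by lra.
Qed.

Lemma wsqnorm_parallelogram l u v :
  wsqnorm l (u + v) + wsqnorm l (u - v) = (wsqnorm l u + wsqnorm l v) * 2.
Proof.
rewrite /wsqnorm -!big_split /= mulr_suml; apply: eq_bigr => j _.
by rewrite !mxE -!mulrDr cabs_parallelogram mulrA.
Qed.

Lemma feasible_qform A l v : primal_feasible A l ->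
  qform A v <= wsqnorm l v /\ - qform A v <= wsqnorm l v.
Proof.
move=> [l0 hp hm]; have [v0|v0] := eqVneq (l2norm v) 0.
  rewrite (l2norm_eq0 v0) /qform mulmx0 cdotE mulmx0 mxE oppr0.
  by rewrite wsqnorm_ge0.
have lv : 0 < l2norm v by rewrite lt_neqAle eq_sym v0 l2norm_ge0.
pose w := (l2norm v)^-1%:C *: v.
have vw : v = (l2norm v)%:C *: w.
  by rewrite scalerA -rmorphM /= mulfV // scale1r.
have sw : usphere w.
  by rewrite /usphere /= l2normZ cabsr gtr0_norm ?invr_gt0 // mulVf.
rewrite vw qformZ wsqnormZ -mulrN cabsr gtr0_norm //.
by split; rewrite ler_pM2l ?exprn_gt0 //; [apply: hp|apply: hm].
Qed.

(** Polarisation controls the sesquilinear form of [A] by its quadratic form,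
and the freedom to rescale [u] against [v] makes the bound a Cauchy-Schwarz
inequality for the weighted norm. *)
Lemma feasible_cs A l u v : A \is hermsymmx -> primal_feasible A l ->
  cabs (cdot (A *m u) v) <= Num.sqrt (wsqnorm l u) * Num.sqrt (wsqnorm l v).
Proof.
move=> hA fl; have l0 : forall j, 0 <= l 0 j by case: fl.
have [w w1 <-] := cabs_phase (cdot (A *m u) v).
have <- : wsqnorm l (w *: u) = wsqnorm l u by rewrite wsqnormZ w1 expr1n mul1r.
rewrite -cdotZl scalemxAr; move: (w *: u) => {}u.
apply: young_sqrt => [||t t0]; try exact: wsqnorm_ge0.
have st : 0 < Num.sqrt t by rewrite sqrtr_gt0.
pose u' := (Num.sqrt t)%:C *: u; pose v' := (Num.sqrt t)^-1%:C *: v.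
have -> : cdot (A *m u) v = cdot (A *m u') v'.
  rewrite -scalemxAr cdotZl cdotZr conjr mulrA -rmorphM /=.
  by rewrite mulfV ?gt_eqF // mul1r.
have -> : t * wsqnorm l u = wsqnorm l u'.
  by rewrite wsqnormZ cabsr gtr0_norm // sqr_sqrtr // ltW.
have -> : t^-1 * wsqnorm l v = wsqnorm l v'.
  by rewrite wsqnormZ cabsr gtr0_norm ?invr_gt0 // exprVn sqr_sqrtr // ltW.
have := herm_polarization u' v' hA.
have [h1 _] := feasible_qform (u' + v') fl.
have [_ h2] := feasible_qform (u' - v') fl.
have := wsqnorm_parallelogram l u' v'.
by lra.
Qed.

Lemma DeltaE d v j : (Delta d *m v) j 0 = (d 0 j)%:C * v j 0.
Proof. by rewrite /Delta mul_diag_mx !mxE. Qed.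

Lemma cdot_Delta d u v : cdot (Delta d *m u) v = cdot u (Delta d *m v).
Proof.
apply: eq_bigr => j _; rewrite !DeltaE rmorphM /= conjr.
by rewrite -mulrA mulrCA.
Qed.

Lemma Delta_sandwich d X i j :
  (Delta d *m X *m Delta d) i j = (d 0 i)%:C * X i j * (d 0 j)%:C.
Proof. by rewrite /Delta mul_mx_diag mul_diag_mx !mxE. Qed.

Lemma Delta_sandwich_herm d X : X \is hermsymmx ->
  Delta d *m X *m Delta d \is hermsymmx.
Proof.
move=> hX; rewrite hermsymmxE; apply/eqP/matrixP => i j.
rewrite [RHS]mxE [in RHS]mxE !Delta_sandwich !rmorphM /= !conjr.
rewrite -{1}(hermsymmx_eq hX) !mxE.
by rewrite mulrC mulrA mulrAC.
Qed.

(** Dividing [A] by the square roots of a feasible vector: the matrix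
inequalities between [A] and the diagonal matrix of [l] say exactly that the
quotient is a contraction. Where an entry of [l] vanishes, so do the
corresponding row and column of [A], hence inverting 0 to 0 is harmless. *)
Lemma feasible_factorization A l : A \is hermsymmx -> primal_feasible A l ->
  exists B, [/\ B \is hermsymmx,
    A = Delta (\row_j Num.sqrt (l 0 j)) *m B *m Delta (\row_j Num.sqrt (l 0 j)),
    opnorm B <= 1 &
    forall i j, l 0 j = 0 -> B i j = 0].
Proof.
move=> hA fl; have l0 : forall j, 0 <= l 0 j by case: fl.
set d := \row_j _; pose e : 'rV[R]_n := \row_j (d 0 j)^-1.
exists (Delta e *m A *m Delta e); split.
- exact: Delta_sandwich_herm.
- apply/matrixP => i j; rewrite !Delta_sandwich.
  have A0 k : d 0 k = 0 -> forall m, A m k = 0.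
    rewrite mxE => /eqP; rewrite sqrtr_eq0 => lk m.
    have lk0 : l 0 k = 0 by apply/eqP; rewrite eq_le lk l0.
    have := feasible_cs (delta_mx k 0) (delta_mx m 0) hA fl.
    rewrite cdot_delta wsqnorm_delta lk0 sqrtr0 mul0r => Ak0.
    by apply/eqP; rewrite -cabs_eq0 eq_le cabs_ge0 andbT.
  have [dj|dj] := eqVneq (d 0 j) 0; first by rewrite dj mulr0 A0.
  have [di|di] := eqVneq (d 0 i) 0.
    rewrite di !mul0r -(hermsymmx_eq hA) !mxE (A0 _ di) //.
    exact: rmorph0.
  rewrite ![e 0 _]mxE !mulrA -rmorphM /= mulfV // mul1r -mulrA -rmorphM /=.
  by rewrite mulVf // mulr1.
- apply: opnorm_le => // u v; apply: le_trans (Re_le_cabs _) _.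
  rewrite mul1r -!mulmxA cdot_Delta; apply: le_trans (feasible_cs _ _ hA fl) _.
  have le1 w : Num.sqrt (wsqnorm l (Delta e *m w)) <= l2norm w.
    apply: ler_wsqrtr; apply: ler_sum => j _; rewrite DeltaE cabsM exprMn cabsr.
    rewrite real_normK ?num_real // !mxE exprVn sqr_sqrtr // mulrA.
    have [->|lj] := eqVneq (l 0 j) 0; first by rewrite !mul0r sqr_ge0.
    by rewrite mulfV // mul1r.
  by rewrite ler_pM ?sqrtr_ge0.
- move=> i j lj; have ej : e 0 j = 0 by rewrite !mxE lj sqrtr0 invr0.
  by rewrite Delta_sandwich ej mulr0.
Qed.

(** Moving the diagonal factors onto a vector turns the trace pairing with [Y]
into a value of the sesquilinear form of a Schur product with [Y]. *)
Lemma trace_factorization Y B d c : 0 < c -> opnorm B <= c ->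
  cabs (\tr (Y^t* *m (Delta d *m B *m Delta d)))
  <= schur_norm Y * c * \sum_j d 0 j ^+ 2.
Proof.
move=> c0 Bc; pose x : 'cV[C]_n := \col_j (d 0 j)%:C.
have lx : l2norm x ^+ 2 = \sum_j d 0 j ^+ 2.
  by rewrite l2norm_sqr; apply: eq_bigr => j _; rewrite mxE cabsr real_normK ?num_real.
have -> : \tr (Y^t* *m (Delta d *m B *m Delta d))
    = ((cdot (schur Y (map_mx Num.conj B) *m x) x)^*)%R.
  rewrite cdot_entries rmorph_sum /= /mxtrace.
  under [LHS]eq_bigr do rewrite mxE.
  rewrite exchange_big /=.
  apply: eq_bigr => i _; rewrite rmorph_sum; apply: eq_bigr => j _ /=.
  rewrite Delta_sandwich !mxE !rmorphM /= conjCK !conjr.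
  by rewrite -!mulrA; congr (_ * _); rewrite mulrC -mulrA.
rewrite cabs_conj -lx; apply: le_trans (opnorm_cdot _ _ _) _.
rewrite -mulrA -expr2 ler_wpM2r ?sqr_ge0 //.
by apply: schur_norm_ub => //; apply: le_trans (opnorm_conj _) Bc.
Qed.

Lemma feasible_trace A l Y : A \is hermsymmx -> primal_feasible A l ->
  cabs (\tr (Y^t* *m A)) <= schur_norm Y * primal_obj l.
Proof.
move=> hA fl; have [B [_ AB B1 _]] := feasible_factorization hA fl.
rewrite {1}AB; apply: le_trans (trace_factorization Y _ ltr01 B1) _.
rewrite mulr1 /primal_obj le_eqVlt; apply/predU1P; left; congr (_ * _).
by apply: eq_bigr => j _; rewrite mxE sqr_sqrtr //; case: fl.
Qed.

Lemma dual_norm_le_primal A l : A \is hermsymmx -> primal_feasible A l ->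
  schur_dual_norm A <= primal_obj l.
Proof.
move=> hA fl; apply: schur_dual_norm_le => Y Y1.
apply: le_trans (feasible_trace Y hA fl) _; rewrite ler_piMl //.
by apply: sumr_ge0 => j _; case: fl.
Qed.

End Hermitian.

(** * Positive matrices *)

Section Positive.
Context {R : realType} {n : nat}.
Local Notation C := R[i].
Local Notation Re := (@complex.Re R).
Local Notation Im := (@complex.Im R).
Local Notation proj := Defs.proj.
Implicit Types (u v w xi : 'cV[C]_n) (A X Y Q S : 'M[C]_n) (a : C) (c x t : R).

Lemma projE xi i j : proj xi i j = xi i 0 * ((xi j 0)^*)%R.
Proof. by rewrite mxE big_ord1 !mxE. Qed.

Lemma cdot_proj xi v : cdot (proj xi *m v) v = (cabs (cdot v xi) ^+ 2)%:C.
Proof.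
rewrite cabs_sqr cdotE /proj !mulmxA -mulmxA mxE big_ord1 -!cdotE.
by rewrite cdot_conj mulrC.
Qed.

Lemma trace_proj A xi : \tr (proj xi *m A) = cdot (A *m xi) xi.
Proof.
by rewrite /Defs.proj -mulmxA mxtrace_mulC cdotE /mxtrace big_ord1 mulmxA.
Qed.

Lemma psd_proj xi : psd (proj xi).
Proof. by move=> v; rewrite cdot_proj ler0c sqr_ge0. Qed.

Lemma psdD Q S : psd Q -> psd S -> psd (Q + S).
Proof. by move=> hQ hS v; rewrite mulmxDl cdotDl addr_ge0. Qed.

Lemma psdZ c Q : 0 <= c -> psd Q -> psd (c%:C *: Q).
Proof.
by move=> c0 hQ v; rewrite -scalemxAl cdotZl mulr_ge0 // ler0c.
Qed.

Lemma psd0 : psd (0 : 'M[C]_n).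
Proof. by move=> v; rewrite mul0mx cdotE mulmx0 mxE. Qed.

Lemma psd_sum (I : Type) (r : seq I) (P : pred I) (F : I -> 'M[C]_n) :
  (forall i, P i -> psd (F i)) -> psd (\sum_(i <- r | P i) F i).
Proof.
by move=> h; elim/big_ind: _ => //; [exact: psd0|exact: psdD].
Qed.

Lemma psd_Im0 Q v : psd Q -> Im (cdot (Q *m v) v) = 0.
Proof. by move=> /(_ v) /ger0_Im. Qed.

(** Over the complex numbers a quadratic form with real values already comes
from a self-adjoint matrix, by polarisation along [u + v] and [i u + v]. *)
Lemma psd_herm Q : psd Q -> Q \is hermsymmx.
Proof.
move=> hQ; rewrite hermsymmxE; apply/eqP/matrixP => i j; rewrite !mxE.
have pol u v : cdot (Q *m u) v = ((cdot (Q *m v) u)^*)%R.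
  have e1 : Im (cdot (Q *m u) v) = - Im (cdot (Q *m v) u).
    have := psd_Im0 (u + v) hQ; rewrite mulmxDr cdotDr !cdotDl !raddfD /=.
    by rewrite !(psd_Im0 _ hQ); lra.
  have e2 : Re (cdot (Q *m u) v) = Re (cdot (Q *m v) u).
    have := psd_Im0 ('i%C *: u + v) hQ.
    rewrite mulmxDr cdotDr !cdotDl !raddfD /= !(psd_Im0 _ hQ) -scalemxAr.
    rewrite cdotZl cdotZr !ImM Re_conj Im_conj /=.
    by lra.
  apply/eqP; rewrite eq_complex Re_conj Im_conj e1 e2.
  by rewrite !eqxx.
by rewrite -!cdot_delta.
Qed.

(** The spectral theorem, with eigenvalues read off as values of the quadratic
form at the unit eigenvectors; these are the atoms of finite dual solutions. *)
Lemma psd_spectral Q : psd Q ->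
  exists (m : 'I_n -> R) (xi : 'I_n -> 'cV[C]_n),
    [/\ forall k, 0 <= m k, forall k, usphere (xi k)
      & Q = \sum_k (m k)%:C *: proj (xi k)].
Proof.
move=> hQ; have hh := psd_herm hQ.
have /orthomx_spectralP := hermitian_normalmx hh.
set P := spectralmx Q; set D := spectral_diag Q.
have uP : P \is unitarymx := spectral_unitarymx Q.
have PP : P *m P^t* = 1%:M by apply/unitarymxP.
rewrite invmx_unitary // => QE.
pose xi k := (row k P)^t*.
have xiE k : xi k = col k (P^t*) by apply/matrixP => i j; rewrite !mxE.
have sandwich X k : cdot (X *m xi k) (xi k) = (P *m (X *m P^t*)) k k.
  rewrite cdotE trmxCK {1}xiE rowE colE.
  set a : 'rV_n := delta_mx 0 k; set b : 'cV_n := delta_mx k 0.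
  have -> : a *m P *m (X *m (P^t* *m b)) = a *m (P *m (X *m P^t*)) *m b.
    by rewrite !mulmxA.
  by rewrite -rowE -colE mxE mxE.
have dotP k : cdot (Q *m xi k) (xi k) = D 0 k.
  rewrite sandwich QE !mulmxA PP mul1mx -mulmxA PP mulmx1.
  by rewrite mxE eqxx mulr1n.
exists (fun k => Re (D 0 k)), xi; split.
- by move=> k; rewrite -dotP -lecR RRe_real ?ger0_real // hQ.
- move=> k; apply/eqP; rewrite -(@eqrXn2 _ 2) ?l2norm_ge0 // expr1n -Re_cdotvv.
  by rewrite -{1}[xi k]mul1mx sandwich mul1mx PP mxE eqxx.
- apply/matrixP => i j; rewrite summxE {1}QE mxE.
  apply: eq_bigr => k _; rewrite [RHS]mxE RRe_real; last first.
    by rewrite -dotP ger0_real // hQ.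
  rewrite projE mul_mx_diag !mxE conjCK mulrAC.
  by rewrite mulrC mulrA.
Qed.

End Positive.

(** * The matrix form of the dual program *)

Section Duality.
Context {R : realType} {n : nat}.
Local Notation C := R[i].
Local Notation Re := (@complex.Re R).
Local Notation Im := (@complex.Im R).
Local Notation proj := Defs.proj.
Implicit Types (u v w xi : 'cV[C]_n) (A X Y Q S : 'M[C]_n) (a : C) (c x t : R).
Implicit Types (l : 'rV[R]_n).

Definition rdiag Q : 'rV[R]_n := \row_j Re (Q j j).

Definition pair_value A Q S : R := Re (\tr ((Q - S) *m A)).

(** The dual program in matrix form: a family of weights on the unit sphere only
enters through the two positive matrices it sums to. *)
Definition pair_feasible Q S : Prop :=
  [/\ psd Q, psd S & forall j, Re (Q j j) + Re (S j j) <= 1].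

Lemma psd_diag_ge0 Q j : psd Q -> 0 <= Re (Q j j).
Proof.
move=> /(_ (delta_mx j 0)); rewrite cdot_delta => h.
by rewrite -ler0c RRe_real // ger0_real.
Qed.

(** A rank one positive factor [xi xi^*] acts under the Schur product as
multiplication of both arguments of the form by the conjugate of [xi], so no
norm is lost on it; the diagonal of [Q] collects what the factors contribute
to each coordinate. Young's inequality rather than Cauchy-Schwarz is used
because its bound adds up over several positive matrices. *)
Lemma psd_schur_young Q X u v t : psd Q -> opnorm X <= 1 -> 0 < t ->
  cabs (cdot (schur Q X *m u) v) * 2
  <= t * wsqnorm (rdiag Q) u + t^-1 * wsqnorm (rdiag Q) v.
Proof.
move=> hQ X1 t0; have [m [xi [m0 _ QE]]] := psd_spectral hQ.
pose tw k u := \col_j (((xi k j 0)^*)%R * u j 0).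
have twE w : wsqnorm (rdiag Q) w = \sum_k m k * l2norm (tw k w) ^+ 2.
  under [RHS]eq_bigr do rewrite l2norm_sqr mulr_sumr.
  rewrite exchange_big; apply: eq_bigr => j _ /=.
  rewrite mxE {1}QE summxE Re_sum mulr_suml; apply: eq_bigr => k _.
  rewrite mxE ReMr projE Re_sqr -mulrA; congr (_ * _).
  by rewrite mxE cabsM cabs_conj exprMn.
have -> : cdot (schur Q X *m u) v
    = \sum_k (m k)%:C * cdot (X *m tw k u) (tw k v).
  under [RHS]eq_bigr do rewrite cdot_entries mulr_sumr.
  rewrite cdot_entries [RHS]exchange_big; apply: eq_bigr => i _ /=.
  under [RHS]eq_bigr do rewrite mulr_sumr.
  rewrite [RHS]exchange_big; apply: eq_bigr => j _ /=.
  rewrite mxE {1}QE summxE !mulr_suml; apply: eq_bigr => k _.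
  rewrite mxE projE !mxE rmorphM /= conjCK -!mulrA; congr (_ * _).
  by ring.
rewrite !twE !mulr_sumr -big_split /=.
apply: le_trans (ler_wpM2r _ (cabs_sum _ _ _)) _ => //.
rewrite mulr_suml; apply: ler_sum => k _.
rewrite cabsM cabsr ger0_norm // ![_ * (m k * _)]mulrCA -mulrDr -mulrA.
rewrite ler_wpM2l //; apply: le_trans (young _ _ t0); rewrite ler_wpM2r //.
apply: le_trans (opnorm_cdot _ _ _) _; rewrite -mulrA ler_piMl //.
by rewrite mulr_ge0 ?l2norm_ge0.
Qed.

Lemma psd_entry_le Q i j : psd Q ->
  cabs (Q i j) * 2 <= Re (Q i i) + Re (Q j j).
Proof.
move=> hQ; have := psd_schur_young (delta_mx j 0) (delta_mx i 0) hQ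
  (opnorm_delta_le1 i j) ltr01.
by rewrite cdot_delta !wsqnorm_delta !mxE !eqxx mulr1 invr1 !mul1r addrC.
Qed.

(** The elementary half of the description of the Schur norm of a self-adjoint
matrix: the diagonals of [Q] and [S] add up, whatever the sign in front of
[S]. *)
Lemma pair_schur_norm Q S : pair_feasible Q S -> schur_norm (Q - S) <= 1.
Proof.
move=> [hQ hS QS1]; apply: schur_norm_le => X X1.
apply: opnorm_le => // u v; apply: le_trans (Re_le_cabs _) _.
have dle w : wsqnorm (rdiag Q) w + wsqnorm (rdiag S) w
    <= \sum_j cabs (w j 0) ^+ 2.
  rewrite -big_split /=; apply: ler_sum => j _.
  by rewrite -mulrDl !mxE ler_piMl ?sqr_ge0.
rewrite mul1r; apply: young_sqrt => [||t t0];
  try by apply: sumr_ge0 => j _; apply: sqr_ge0.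
have -> : schur (Q - S) X = schur Q X - schur S X.
  by apply/matrixP => i j; rewrite !mxE mulrBl.
rewrite mulmxBl cdotDl cdotNl.
have := cabsD (cdot (schur Q X *m u) v) (- cdot (schur S X *m u) v).
rewrite cabsN.
have := psd_schur_young u v hQ X1 t0.
have := psd_schur_young u v hS X1 t0.
have h1 := ler_wpM2l (ltW t0) (dle u).
have t1 : 0 <= t^-1 by rewrite invr_ge0 ltW.
have h2 := ler_wpM2l t1 (dle v).
by rewrite !mulrDr in h1 h2; lra.
Qed.

Lemma pair_value_le A Q S : pair_feasible Q S ->
  pair_value A Q S <= schur_dual_norm A.
Proof.
move=> QS; have [hQ hS _] := QS; apply: le_trans (Re_le_cabs _) _.
have -> : Q - S = (Q - S)^t*.
  rewrite linearB /= map_mxB.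
  by rewrite !(hermsymmx_eq (psd_herm _)).
exact/schur_dual_norm_ub/pair_schur_norm.
Qed.

Definition pos_sqr x : R := Num.max x 0 ^+ 2.

(** Squared positive parts vanish exactly when the constraints hold and the value
[c] is reached, and they have a derivative: twice the violation. *)
Definition penalty A c Q S : R :=
  pos_sqr (c - pair_value A Q S)
  + \sum_j pos_sqr (Re (Q j j) + Re (S j j) - 1).

(** This one-sided quadratic bound does the work of the derivative of
[pos_sqr]. *)
Lemma pos_sqrD x t : pos_sqr (x + t) <= pos_sqr x + 2 * t * Num.max x 0 + t ^+ 2.
Proof.
rewrite /pos_sqr; have [x0|x0] := leP x 0; have [y0|y0] := leP (x + t) 0.
- by rewrite expr0n /= mulr0 !add0r sqr_ge0.
- rewrite expr0n /= mulr0 !add0r ler_sqr ?nnegrE; lra.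
- rewrite expr0n /=; have := sqr_ge0 (x + t); rewrite !expr2; nra.
- by rewrite !expr2; nra.
Qed.

Lemma slope_ge0 (b e : R) :
  (forall s, 0 < s -> s <= 1 -> 0 <= s * b + s ^+ 2 * e) -> 0 <= b.
Proof.
move=> h; rewrite leNgt; apply/negP => b0.
have k0 : 0 < `|e| + 1 - b by have := normr_ge0 e; lra.
pose s := - b / (`|e| + 1 - b).
have s0 : 0 < s by rewrite divr_gt0 // oppr_gt0.
have s1 : s <= 1 by rewrite ler_pdivrMr //; have := normr_ge0 e; lra.
have := h s s0 s1; rewrite expr2 -mulrA -mulrDr pmulr_rge0 //.
have es : s * (`|e| + 1 - b) = - b by rewrite divfK // gt_eqF.
have : s * e <= s * `|e| by rewrite ler_pM2l // ler_norm.
by nra.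
Qed.

(** Along a curve whose value and diagonal move linearly with [s], minimality
of the penalty gives a first-order inequality, whose multipliers are the
positive parts of the constraint violations. *)
Lemma penalty_first_order A c Q S (Q' S' : R -> 'M[C]_n) (b : R) (e : 'I_n -> R) :
  (forall s, 0 < s -> s <= 1 -> [/\
    penalty A c Q S <= penalty A c (Q' s) (S' s),
    pair_value A (Q' s) (S' s) = pair_value A Q S + s * b &
    forall j, Re (Q' s j j) + Re (S' s j j) = Re (Q j j) + Re (S j j) + s * e j]) ->
  Num.max (c - pair_value A Q S) 0 * b
  <= \sum_j Num.max (Re (Q j j) + Re (S j j) - 1) 0 * e j.
Proof.
move=> h; rewrite -subr_ge0.
apply: (@slope_ge0 _ ((b ^+ 2 + \sum_j e j ^+ 2) / 2)) => s s0 s1.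
have [+ Eb Ee] := h s s0 s1; rewrite /penalty Eb.
under [X in _ + _ <= _ + X]eq_bigr do rewrite Ee.
move=> hle; have h1 := pos_sqrD (c - pair_value A Q S) (- (s * b)).
have h2 : \sum_j pos_sqr (Re (Q j j) + Re (S j j) + s * e j - 1) <=
    \sum_j pos_sqr (Re (Q j j) + Re (S j j) - 1)
    + 2 * s * (\sum_j Num.max (Re (Q j j) + Re (S j j) - 1) 0 * e j)
    + s ^+ 2 * \sum_j e j ^+ 2.
  rewrite !mulr_sumr -!big_split /=; apply: ler_sum => j _.
  rewrite [X in pos_sqr X <= _]addrAC; apply: le_trans (pos_sqrD _ _) _.
  by rewrite exprMn -!mulrA; lra.
move: hle h1 h2; rewrite opprD addrA sqrrN exprMn.
by lra.
Qed.

(** At a minimum of the penalty the excess [al] of [c] over the reached value and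
the excesses [la j] of the diagonal entries over 1 are Lagrange multipliers.
The first-order conditions say that [la] is feasible for [al] times [A] and that
the sum of [la] is smaller than [al * c] as soon as some excess is nonzero; so
either [al] is positive and [la / al] is feasible for [A], or nothing is
violated. *)
Lemma penalty_alternative A c Q S : psd Q -> psd S ->
  (forall Q' S', psd Q' -> psd S' -> penalty A c Q S <= penalty A c Q' S') ->
  (exists2 l, primal_feasible A l & primal_obj l < c) \/
  (pair_feasible Q S /\ c <= pair_value A Q S).
Proof.
move=> hQ hS hmin.
set al := Num.max (c - pair_value A Q S) 0.
pose la j := Num.max (Re (Q j j) + Re (S j j) - 1) 0.
have al0 : 0 <= al by rewrite le_max lexx orbT.
have la0 j : 0 <= la j by rewrite le_max lexx orbT.
have projdiag s v j : Re ((s%:C *: proj v) j j) = s * cabs (v j 0) ^+ 2.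
  by rewrite mxE ReMr projE Re_sqr.
have projval s v : Re (\tr (s%:C *: proj v *m A)) = s * qform A v.
  by rewrite -scalemxAl mxtraceZ ReMr trace_proj.
(* The feasibility inequalities come from adding a small multiple of a rank
   one projection to [Q], respectively to [S]. *)
have up v : al * qform A v <= \sum_j la j * cabs (v j 0) ^+ 2.
  apply: (@penalty_first_order A c Q S
    (fun s => Q + s%:C *: proj v) (fun=> S)) => s s0 s1.
  split.
  - by apply: hmin => //; apply: psdD => //; apply: psdZ (ltW s0) (psd_proj _).
  - by rewrite /pair_value addrAC mulmxDl mxtraceD ReD projval.
  - by move=> j /=; rewrite [(Q + _) j j]mxE ReD projdiag addrAC.
have dn v : al * - qform A v <= \sum_j la j * cabs (v j 0) ^+ 2.
  apply: (@penalty_first_order A c Q S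
    (fun=> Q) (fun s => S + s%:C *: proj v)) => s s0 s1.
  split.
  - by apply: hmin => //; apply: psdD => //; apply: psdZ (ltW s0) (psd_proj _).
  - by rewrite /pair_value opprD addrA mulmxBl linearB /= ReB projval mulrN.
  - by move=> j /=; rewrite [(S + _) j j]mxE ReD projdiag addrA.
(* Shrinking the pair towards 0 gives complementary slackness. *)
have sc : al * - pair_value A Q S <= \sum_j la j * - (Re (Q j j) + Re (S j j)).
  apply: (@penalty_first_order A c Q S
    (fun s => (1 - s)%:C *: Q) (fun s => (1 - s)%:C *: S)) => s s0 s1.
  split.
  - by apply: hmin; apply: psdZ; rewrite ?subr_ge0.
  - rewrite /pair_value -scalerBr -scalemxAl mxtraceZ ReMr; lra.
  - by move=> j; rewrite !mxE !ReMr; lra.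
have laE j : la j * (Re (Q j j) + Re (S j j)) = la j + la j ^+ 2.
  rewrite /la; case: leP => h; first by rewrite !mul0r expr0n addr0.
  by rewrite expr2; lra.
have alE : al * pair_value A Q S = al * c - al ^+ 2.
  rewrite /al; case: leP => h; first by rewrite !mul0r expr0n subr0.
  by rewrite expr2; lra.
have key : \sum_j la j + \sum_j la j ^+ 2 + al ^+ 2 <= al * c.
  have -> : \sum_j la j + \sum_j la j ^+ 2
      = \sum_j la j * (Re (Q j j) + Re (S j j)).
    by rewrite -big_split; apply: eq_bigr => j _; rewrite laE.
  move: sc; rewrite mulrN alE.
  have -> : \sum_j la j * - (Re (Q j j) + Re (S j j))
      = - \sum_j la j * (Re (Q j j) + Re (S j j)).
    by rewrite -sumrN; apply: eq_bigr => j _; rewrite mulrN.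
  by lra.
have s2 : 0 <= \sum_j la j ^+ 2 by apply: sumr_ge0 => j _; apply: sqr_ge0.
have [al1|al1] := leP al 0; [right|left].
  have alz : al = 0 by apply/eqP; rewrite eq_le al1 al0.
  have s1 : 0 <= \sum_j la j by apply: sumr_ge0.
  have sum0 : \sum_j la j = 0 by move: key; rewrite alz expr0n mul0r /=; lra.
  split; last first.
    by move: al1; rewrite ge_max subr_le0 => /andP[].
  split => // j; move/eqP: sum0; rewrite psumr_eq0 // => /allP /(_ j).
  rewrite mem_index_enum => /(_ isT) /eqP h.
  by rewrite -subr_le0 -h le_max lexx.
exists (\row_j (al^-1 * la j)).
  have wE v : \sum_j (\row_j (al^-1 * la j)) 0 j * cabs (v j 0) ^+ 2
      = al^-1 * \sum_j la j * cabs (v j 0) ^+ 2.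
    by rewrite mulr_sumr; apply: eq_bigr => j _; rewrite mxE -mulrA.
  split => [j|v _|v _]; first by rewrite mxE mulr_ge0 // invr_ge0.
    by rewrite wE ler_pdivlMl.
  by rewrite wE ler_pdivlMl.
rewrite /primal_obj; under eq_bigr do rewrite mxE; rewrite -mulr_sumr.
rewrite ltr_pdivrMl //.
have : 0 < al ^+ 2 by rewrite exprn_gt0.
by lra.
Qed.

End Duality.

(** * Existence of minimisers and strong duality *)

Section Continuity.
Context {R : realType} {T : topologicalType}.
Implicit Types (f g : T -> R) (c : R).

Lemma cont_cst c : continuous (fun _ : T => c).
Proof. by move=> x; apply: cvg_cst. Qed.

Lemma contD f g : continuous f -> continuous g ->
  continuous (fun x => f x + g x).
Proof. by move=> cf cg x; apply: (@continuousD _ _ _ f g); [apply: cf|apply: cg]. Qed.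

Lemma contM f g : continuous f -> continuous g ->
  continuous (fun x => f x * g x).
Proof. by move=> cf cg x; apply: (@continuousM _ _ f g); [apply: cf|apply: cg]. Qed.

Lemma contB f g : continuous f -> continuous g ->
  continuous (fun x => f x - g x).
Proof. by move=> cf cg x; apply: (@continuousB _ _ _ f g); [apply: cf|apply: cg]. Qed.

Lemma cont_sum (I : finType) (F : I -> T -> R) :
  (forall i, continuous (F i)) -> continuous (fun x => \sum_i F i x).
Proof.
by move=> cF; apply: continuous_big => // -[a b]; apply: add_continuous.
Qed.

Lemma cont_pos_sqr f : continuous f -> continuous (fun x => pos_sqr (f x)).
Proof.
move=> cf; have cm : continuous (fun x => Num.max (f x) 0).
  move=> x; apply: (@continuous_max _ _ f (cst 0)); first exact: cf.
  exact: cvg_cst.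
by move=> x; apply: contM.
Qed.

Lemma closed_nonneg f : continuous f -> closed [set x | 0 <= f x].
Proof.
move=> cf; apply: (@preimage_closed T R f [set y | 0 <= y]); last exact: closed_ge.
by move=> x _; apply: cf. Qed.

Lemma closed_all (I : Type) (P : I -> T -> Prop) :
  (forall i, closed [set x | P i x]) -> closed [set x | forall i, P i x].
Proof.
move=> cP; rewrite (_ : mkset _ = \bigcap_(i in setT) [set x | P i x]).
  by apply: closed_bigI => i _; apply: cP.
by apply/seteqP; split => [x Px i _|x Px i]; apply: Px.
Qed.

Lemma closed_and (P Q : T -> Prop) : closed [set x | P x] ->
  closed [set x | Q x] -> closed [set x | P x /\ Q x].
Proof. by move=> cP cQ; apply: closedI. Qed.

End Continuity.

Section Compactness.
Context {R : realType}.
Local Notation C := R[i].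
Local Notation Re := (@complex.Re R).
Local Notation Im := (@complex.Im R).

Lemma box_min (m : nat) (P : 'rV[R]_m -> Prop) (f : 'rV[R]_m -> R) (K : R) :
  closed [set x | P x] -> (forall x, P x -> forall i, `|x 0 i| <= K) ->
  continuous f -> (exists x, P x) ->
  exists2 x, P x & forall y, P y -> f x <= f y.
Proof.
move=> cP bP cf [x0 Px0].
have comp : compact [set x | P x].
  have cbox : compact [set x : 'rV[R]_m | forall i, `[- K, K]%classic (x ord0 i)].
    by apply: (@rV_compact _ _ (fun=> `[- K, K]%classic)) => i; apply: segment_compact.
  apply: subclosed_compact cP cbox _ => x /= Px i.
  by rewrite in_itv /= -ler_norml bP.
have ne : [set x | P x] !=set0 by exists x0.
have [x + hx] := EVT_min_rV ne comp (continuous_subspaceT cf).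
rewrite inE => Px; exists x => // y Py; apply: hx.
by rewrite inE.
Qed.

Context {n : nat}.
Implicit Types (A M Q S : 'M[C]_n).

Definition pair_index : finType := ('I_n * 'I_n * bool * bool)%type.

(** A pair of complex matrices in real coordinates: the first boolean selects
the matrix, the second one the imaginary part. *)
Definition pair_mx (b : bool) (x : 'rV[R]_#|pair_index|) : 'M[C]_n :=
  \matrix_(i, j) (x 0 (enum_rank ((i, j, b, false) : pair_index))
                  +i* x 0 (enum_rank ((i, j, b, true) : pair_index))).

Lemma pair_mx_surj Q S : exists x, pair_mx false x = Q /\ pair_mx true x = S.
Proof.
exists (\row_k let: (i, j, b, e) := enum_val k in
   let z := (if b then S else Q) i j in if e then Im z else Re z).
by split; apply/matrixP => i j; rewrite !mxE !enum_rankK /=; case: (_ i j).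
Qed.

Lemma cont_trace b M : continuous (fun x => Re (\tr (pair_mx b x *m M))).
Proof.
have -> : (fun x => Re (\tr (pair_mx b x *m M)))
   = (fun x => \sum_i \sum_j
       (x 0 (enum_rank ((i, j, b, false) : pair_index)) * Re (M j i)
       - x 0 (enum_rank ((i, j, b, true) : pair_index)) * Im (M j i))).
  apply/funext => x; rewrite Re_sum; apply: eq_bigr => i _.
  by rewrite mxE Re_sum; apply: eq_bigr => j _; rewrite mxE ReM.
apply: cont_sum => i; apply: cont_sum => j; apply: contB; apply: contM;
  by [apply: coord_continuous|apply: cont_cst].
Qed.

Lemma closed_psd b : closed [set x | psd (pair_mx b x)].
Proof.
apply: closed_all => v.
have -> : [set x | 0 <= cdot (pair_mx b x *m v) v]
  = [set x | 0 <= Re (\tr (pair_mx b x *m Defs.proj v)) /\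
     (0 <= Re (\tr (pair_mx b x *m ('i%C *: Defs.proj v))) /\
      0 <= Re (\tr (pair_mx b x *m (- 'i%C *: Defs.proj v))))].
  apply/seteqP; split => x /=; rewrite -!scalemxAr !mxtraceZ;
    rewrite mxtrace_mulC trace_proj lecE;
    rewrite !ReM /=; move: (Re _) (Im _) => a c; rewrite oppr0.
    by move=> /andP[/eqP -> a0]; rewrite a0; split => //; split; lra.
  by move=> [-> [c1 c2]]; rewrite andbT; apply/eqP; lra.
by do 2![apply: closed_and; first exact/closed_nonneg/cont_trace];
  exact/closed_nonneg/cont_trace.
Qed.

(** Positive matrices are bounded by their diagonal. A pair with a diagonal entry
above [K] pays at least the penalty [Num.max c 0 ^+ 2] of the zero pair for that
entry alone, so the search can be confined to a compact set. *)
Lemma penalty_min A c : exists Q S, [/\ psd Q, psd S &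
  forall Q' S', psd Q' -> psd S' -> penalty A c Q S <= penalty A c Q' S'].
Proof.
pose K : R := 1 + Num.max c 0.
have c0 : 0 <= Num.max c 0 by rewrite le_max lexx orbT.
pose P x := psd (pair_mx false x) /\ psd (pair_mx true x) /\
  forall j, 0 <= K - (Re (pair_mx false x j j) + Re (pair_mx true x j j)).
have tr_delta b x j : Re (pair_mx b x j j) = Re (\tr (pair_mx b x *m delta_mx j j)).
  congr Re; rewrite /mxtrace (bigD1 j) //= big1 ?addr0 => [|i ij].
    rewrite [in RHS]mxE (bigD1 j) //= big1 ?addr0 => [|k kj].
      by rewrite [delta_mx _ _ _ _]mxE !eqxx mulr1.
    by rewrite [delta_mx _ _ _ _]mxE (negPf kj) mulr0.
  rewrite mxE big1 // => k _.
  by rewrite [delta_mx _ _ _ _]mxE (negPf ij) andbF mulr0.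
have cdiag b j : continuous (fun x => Re (pair_mx b x j j)).
  rewrite (_ : (fun x => _) = fun x => Re (\tr (pair_mx b x *m delta_mx j j))).
    exact: cont_trace.
  by apply/funext => x; rewrite tr_delta.
have cP : closed [set x | P x].
  apply: closed_and; first exact: closed_psd.
  apply: closed_and; first exact: closed_psd.
  apply: closed_all => j; apply: closed_nonneg; apply: contB; first exact: cont_cst.
  exact: contD.
have bP x : P x -> forall i, `|x 0 i| <= K.
  move=> [hQ [hS hd]] k; rewrite -(enum_valK k); move: (enum_val k) => [[[i j] b] e].
  have hb : psd (pair_mx b x) by case: b.
  have dle i' : Re (pair_mx b x i' i') <= K.
    have := psd_diag_ge0 i' hQ; have := psd_diag_ge0 i' hS; have := hd i'.
    by case: b {hb}; lra.
  have := psd_entry_le i j hb; have := dle i; have := dle j.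
  have : `|x 0 (enum_rank ((i, j, b, e) : pair_index))| <= cabs (pair_mx b x i j).
    rewrite /cabs normc_def mxE /= -sqrtr_sqr; apply: ler_wsqrtr.
    by case: e; rewrite ?lerDl ?lerDr sqr_ge0.
  by lra.
pose f x := penalty A c (pair_mx false x) (pair_mx true x).
have cf : continuous f.
  apply: contD; last first.
    apply: cont_sum => j; apply: cont_pos_sqr; apply: contB; last exact: cont_cst.
    exact: contD.
  apply: cont_pos_sqr; apply: contB; first exact: cont_cst.
  rewrite /pair_value (_ : (fun x => _) = fun x =>
    Re (\tr (pair_mx false x *m A)) - Re (\tr (pair_mx true x *m A))).
    by apply: contB; exact: cont_trace.
  by apply/funext => x; rewrite mulmxBl linearB /= ReB.
have [z [z0 z1]] := pair_mx_surj 0 0.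
have Pz : P z.
  split; first by rewrite z0; apply: psd0.
  split; first by rewrite z1; apply: psd0.
  by move=> j; rewrite z0 z1 mxE /= addr0 subr0; rewrite /K; lra.
have [x [hQ [hS _]] xmin] := box_min cP bP cf (ex_intro _ z Pz).
exists (pair_mx false x), (pair_mx true x); split => // Q' S' hQ' hS'.
have [y [y0 y1]] := pair_mx_surj Q' S'.
have [Py|] := pselect (P y); first by have := xmin y Py; rewrite /f y0 y1.
move=> nP; apply: le_trans (xmin z Pz) _.
have [j wj] : exists j, K < Re (Q' j j) + Re (S' j j).
  apply/not_existsP => h; apply: nP; rewrite /P y0 y1; split => //; split => // j.
  by rewrite subr_ge0 leNgt; apply/negP/h.
rewrite /f z0 z1 /penalty /pair_value subrr mul0mx mxtrace0 /= subr0.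
rewrite big1 ?addr0 => [|k _]; last first.
  by rewrite mxE /= addr0 sub0r /pos_sqr max_r ?expr0n //; lra.
rewrite (bigD1 j) //= addrCA; apply: ler_wpDr.
  by rewrite addr_ge0 ?sqr_ge0 // sumr_ge0 // => k _; apply: sqr_ge0.
rewrite ler_sqr ?nnegrE //; last by rewrite le_max lexx orbT.
by rewrite le_max; apply/orP; left; move: wj; rewrite /K; lra.
Qed.

(** Strong duality for one threshold [c]: minimise the penalty for violating
the constraints together with the wish to reach the value [c]. If something is
violated at the minimum, the violations are multipliers, hence after
normalisation a feasible vector. *)
Lemma duality_alternative A c :
  (exists2 l, primal_feasible A l & primal_obj l < c) \/
  (exists Q S, pair_feasible Q S /\ c <= pair_value A Q S).
Proof.
have [Q [S [hQ hS hmin]]] := penalty_min A c.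
by have [|h] := penalty_alternative hQ hS hmin; [left|right; exists Q, S].
Qed.

(** With the dual norm itself as threshold, the first alternative would give a
feasible vector below the lower bound for the primal program. *)
Lemma dual_pair_attained A : A \is hermsymmx ->
  exists Q S, pair_feasible Q S /\ pair_value A Q S = schur_dual_norm A.
Proof.
move=> hA.
have [[l fl lt]|[Q [S [QS le]]]] := duality_alternative A (schur_dual_norm A).
  by have := dual_norm_le_primal hA fl; rewrite leNgt lt.
by exists Q, S; split => //; apply/eqP; rewrite eq_le le pair_value_le.
Qed.

Lemma primal_approx A c : A \is hermsymmx -> schur_dual_norm A < c ->
  exists2 l, primal_feasible A l & primal_obj l < c.
Proof.
move=> hA Nc; have [//|[Q [S [QS le]]]] := duality_alternative A c.
by have := le_trans le (pair_value_le A QS); rewrite leNgt Nc.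
Qed.

(** The alternative produces feasible vectors with objective arbitrarily close to
the dual norm; compactness turns them into an optimal one. *)
Lemma primal_attained A : A \is hermsymmx ->
  exists2 l, primal_feasible A l & primal_obj l = schur_dual_norm A.
Proof.
move=> hA; set N := schur_dual_norm A.
pose P (l : 'rV[R]_n) := primal_feasible A l /\ 0 <= N + 1 - primal_obj l.
have cobj : continuous (primal_obj : 'rV[R]_n -> R).
  by apply: cont_sum => j; apply: coord_continuous.
have cw v : continuous (fun l : 'rV[R]_n => wsqnorm l v).
  apply: cont_sum => j; apply: contM; last exact: cont_cst.
  exact: coord_continuous.
have cP : closed [set l | P l].
  apply: closed_and; last by apply/closed_nonneg/contB; first exact: cont_cst.
  rewrite (_ : mkset _ = [set l : 'rV[R]_n | (forall j, 0 <= l 0 j) /\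
     ((forall v : 'cV[C]_n, 0 <= wsqnorm l v - qform A v) /\
      (forall v : 'cV[C]_n, 0 <= wsqnorm l v + qform A v))]).
    apply: closed_and.
      by apply: closed_all => j; apply/closed_nonneg/coord_continuous.
    apply: closed_and; apply: closed_all => v; apply: closed_nonneg.
      by apply: contB => //; exact: cont_cst.
    by apply: contD => //; exact: cont_cst.
  apply/seteqP; split => l /=.
    move=> fl; split; first by case: fl.
    by split=> v; have [h1 h2] := feasible_qform v fl; lra.
  move=> [l0 [h1 h2]]; split => // v _.
    by have := h1 v; rewrite subr_ge0.
  by have := h2 v; rewrite /wsqnorm; lra.
have bP l : P l -> forall i, `|l 0 i| <= N + 1.
  move=> [[l0 _ _]]; rewrite subr_ge0 => le i; rewrite ger0_norm //.
  apply: le_trans le; rewrite /primal_obj (bigD1 i) //= lerDl.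
  exact: sumr_ge0.
have [|l1 fl1 lt1] := @primal_approx A (N + 1) hA; first by rewrite ltrDl.
have [|l [fl leN] lmin] := box_min cP bP cobj.
  by exists l1; split => //; rewrite subr_ge0 ltW.
exists l => //; apply/eqP; rewrite eq_le dual_norm_le_primal // andbT.
rewrite leNgt; apply/negP => lt.
have [l2 fl2 lt2] := primal_approx hA lt.
have := lmin l2 (conj fl2 _); rewrite [primal_obj l <= _]leNgt lt2.
by move=> h; apply: notF; apply: h; move: leN; lra.
Qed.

End Compactness.

(** * Families on the unit sphere *)

Section FiniteSupport.
Context {R : realType} {T : choiceType}.
Implicit Types (D : set T) (s : seq T).

Lemma fsbig_carried (V : nmodType) D s (f : T -> V) :
  uniq s -> [set` s] `<=` D -> (forall x, D x -> x \notin s -> f x = 0) ->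
  \sum_(x \in D) f x = \sum_(x <- s) f x.
Proof.
move=> us sD f0; rewrite (fsbigE s) //.
rewrite big_seq_cond [RHS]big_seq_cond; apply: eq_bigl => x.
by rewrite andbT; case: (boolP (x \in s)) => //= xs; rewrite mem_set //; apply: sD.
Qed.

Lemma esum_carried D s (f : T -> R) :
  uniq s -> [set` s] `<=` D -> (forall x, D x -> x \notin s -> f x = 0) ->
  (forall x, D x -> 0 <= f x) ->
  \esum_(x in D) (f x)%:E = (\sum_(x <- s) f x)%:E.
Proof.
move=> us sD f0 fge; rewrite (esumID [set` s]); last first.
  by move=> x Dx; rewrite lee_fin fge.
rewrite (setIidr sD) [X in (_ + X)%E]esum1 ?adde0.
  rewrite esum_fset; last 2 first.
  - exact: finite_seq.
  - by move=> x; rewrite inE => /sD/fge; rewrite lee_fin.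
  by rewrite -fsbig_seq // sumEFin.
by move=> x [Dx /= /negP xs]; rewrite f0.
Qed.

Lemma rsum_carried D s (f : T -> R) :
  uniq s -> [set` s] `<=` D -> (forall x, D x -> x \notin s -> f x = 0) ->
  rsum D f = \sum_(x <- s) f x.
Proof.
move=> us sD f0; rewrite /rsum !(@esum_carried _ s) //=.
- rewrite -sumrB; apply: eq_bigr => x _.
  by rewrite /Num.max; do 2![case: ifP]; lra.
- by move=> x Dx xs; rewrite f0 // oppr0 maxxx.
- by move=> x _; rewrite le_max lexx orbT.
- by move=> x Dx xs; rewrite f0 // maxxx.
- by move=> x _; rewrite le_max lexx orbT.
Qed.

(** The negative part only lowers the sum; when infinite it contributes 0, the
value of [fine] there. *)
Lemma rsum_le D (f : T -> R) (c : R) :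
  (\esum_(x in D) (Num.max (f x) 0)%:E <= c%:E)%E -> rsum D f <= c.
Proof.
have pge (g : T -> R) : (0 <= \esum_(x in D) (Num.max (g x) 0)%:E)%E.
  by apply: esum_ge0 => x _; rewrite lee_fin le_max lexx orbT.
rewrite /rsum => h; have n0 := fine_ge0 (pge (fun x => - f x)).
rewrite lerBlDr; apply: le_trans (_ : c <= _); last by rewrite lerDl.
move: h (pge f); case: (esum _ _) => [r||] //=.
Qed.

Lemma rsumN D (f : T -> R) : - rsum D f = rsum D (fun x => - f x).
Proof.
by rewrite /rsum opprB; congr (_ - fine _); apply: eq_esum => x _; rewrite opprK.
Qed.

End FiniteSupport.

Section Families.
Context {R : realType} {n : nat}.
Local Notation C := R[i].
Local Notation Re := (@complex.Re R).
Local Notation proj := Defs.proj.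
Implicit Types (v xi : 'cV[C]_n) (A Q S Y B : 'M[C]_n) (l d : 'rV[R]_n).
Implicit Types (mu nu : 'cV[C]_n -> R).

Lemma finite_carrier mu : finite_set [set xi | usphere xi /\ mu xi != 0] ->
  exists s : seq 'cV[C]_n, [/\ uniq s, [set` s] `<=` usphere &
    forall xi, usphere xi -> xi \notin s -> mu xi = 0].
Proof.
move=> /finite_seqP[s sE]; exists (undup s); split; first exact: undup_uniq.
  move=> x /=; rewrite mem_undup => xs.
  by have [] : [set xi | usphere xi /\ mu xi != 0] x by rewrite sE.
move=> x sx; rewrite mem_undup => xs; apply/eqP/negPn/negP => mx.
move/negP: xs; apply.
by have : [set xi | usphere xi /\ mu xi != 0] x by []; rewrite sE.
Qed.

Section Carried.
Context (mu : 'cV[C]_n -> R) (s : seq 'cV[C]_n).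
Context (us : uniq s) (ss : [set` s] `<=` usphere).
Context (mus : forall xi, usphere xi -> xi \notin s -> mu xi = 0).

Lemma proj_sum_carried : proj_sum mu = \sum_(xi <- s) (mu xi)%:C *: proj xi.
Proof.
by apply: fsbig_carried => // x sx xs; rewrite mus // scale0r.
Qed.

Lemma trace_proj_sum A :
  Re (\tr (proj_sum mu *m A)) = rsum usphere (fun xi => mu xi * qform A xi).
Proof.
rewrite proj_sum_carried (@rsum_carried _ _ _ s) //; last first.
  by move=> x sx xs; rewrite mus // mul0r.
rewrite mulmx_suml (big_morph _ (@mxtraceD _ _) (@mxtrace0 _ _)) Re_sum.
apply: eq_bigr => x _.
by rewrite -scalemxAl mxtraceZ ReMr trace_proj.
Qed.

Context (mu0 : forall xi, usphere xi -> 0 <= mu xi).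

Lemma diag_proj_sum j :
  \esum_(xi in usphere) (mu xi * cabs (xi j 0) ^+ 2)%:E
  = (Re (proj_sum mu j j))%:E.
Proof.
rewrite proj_sum_carried (@esum_carried _ _ _ s) //.
- rewrite summxE Re_sum; congr EFin; apply: eq_bigr => x _.
  by rewrite mxE ReMr projE Re_sqr.
- by move=> x sx xs; rewrite mus // mul0r.
- by move=> x sx; rewrite mulr_ge0 ?sqr_ge0 ?mu0.
Qed.

Lemma psd_proj_sum : psd (proj_sum mu).
Proof.
rewrite proj_sum_carried big_seq; apply: psd_sum => x /ss sx.
exact: psdZ (mu0 sx) (psd_proj x).
Qed.

End Carried.

(** The family carries the eigenvalues on the unit eigenvectors; the weight of a
vector is the sum over all indices giving that vector, so repeated vectors are
counted with their multiplicity. *)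
Lemma psd_proj_sum_ex Q : psd Q -> exists mu,
  [/\ forall xi, 0 <= mu xi, finite_set [set xi | usphere xi /\ mu xi != 0]
    & Q = proj_sum mu].
Proof.
move=> hQ; have [m [xi [m0 xi1 QE]]] := psd_spectral hQ.
pose mu x := \sum_(k | xi k == x) m k; exists mu.
pose s := undup [seq xi k | k : 'I_n].
have mus x : x \notin s -> mu x = 0.
  rewrite mem_undup => xs; rewrite /mu big1 // => k /eqP xk.
  by move: xs; rewrite -xk map_f // mem_enum.
have ss : [set` s] `<=` usphere.
  by move=> x /=; rewrite mem_undup => /mapP[k _ ->].
split.
- by move=> x; apply: sumr_ge0.
- apply: (sub_finite_set _ (finite_seq s)) => x /= [_]; apply: contraR => xs.
  by rewrite mus.
- rewrite (@proj_sum_carried mu s) ?undup_uniq //; last by move=> x _; apply: mus.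
  under eq_bigr do rewrite /mu rmorph_sum scaler_suml big_mkcond /=.
  rewrite exchange_big QE; apply: eq_bigr => k _ /=.
  rewrite -big_mkcond (big_rem (xi k)) /=; last first.
    by rewrite mem_undup map_f // mem_enum.
  rewrite eqxx big_seq_cond big1 ?addr0 // => x /andP[].
  by rewrite mem_rem_uniq ?undup_uniq // inE eq_sym => /andP[/negPf ->].
Qed.

(** For finite families the dual program is the matrix program: constraints and
objective depend only on the two sums of weighted projections. *)
Lemma finite_pair mu nu : finite_family mu nu ->
  (forall xi, usphere xi -> 0 <= mu xi) -> (forall xi, usphere xi -> 0 <= nu xi) ->
  [/\ dual_feasible mu nu <-> pair_feasible (proj_sum mu) (proj_sum nu)
    & forall A, dual_obj A mu nu = pair_value A (proj_sum mu) (proj_sum nu)].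
Proof.
move=> [/finite_carrier[s [us ss mus]] /finite_carrier[t [ut st nut]]] mu0 nu0.
split; last first.
  move=> A; rewrite /pair_value mulmxBl linearB /= ReB.
  by rewrite (trace_proj_sum us ss mus) (trace_proj_sum ut st nut).
split=> [[_ _ h]|[_ _ h]]; split => //.
- exact: psd_proj_sum us ss mus mu0.
- exact: psd_proj_sum ut st nut nu0.
- move=> j; rewrite -lee_fin EFinD -(diag_proj_sum us ss mus mu0).
  by rewrite -(diag_proj_sum ut st nut nu0).
- move=> j; rewrite (diag_proj_sum us ss mus mu0) (diag_proj_sum ut st nut nu0).
  by rewrite -EFinD lee_fin.
Qed.

(** Summing the primal constraint at each [xi] with the weights [mu]; finite
subfamilies suffice because the sum over the sphere is a supremum. *)
Lemma esum_wsqnorm_le l mu (f : 'cV[C]_n -> R) (a : 'I_n -> R) :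
  (forall j, 0 <= l 0 j) -> (forall xi, usphere xi -> 0 <= mu xi) ->
  (forall xi, usphere xi -> f xi <= mu xi * wsqnorm l xi) ->
  (forall j, \esum_(xi in usphere) (mu xi * cabs (xi j 0) ^+ 2)%:E = (a j)%:E) ->
  (\esum_(xi in usphere) (Num.max (f xi) 0)%:E <= (\sum_j l 0 j * a j)%:E)%E.
Proof.
move=> l0 mu0 fle aE; apply: ge_ereal_sup => _ [X [finX Xs] <-].
rewrite fsumEFin // lee_fin.
apply: (@le_trans _ _ (\sum_(x \in X) mu x * wsqnorm l x)).
  rewrite !fsbig_finite // !big_seq; apply: ler_sum => x.
  rewrite in_fset_set // inE => /Xs sx.
  by rewrite ge_max fle // mulr_ge0 ?mu0 ?wsqnorm_ge0.
rewrite fsbig_finite //; under eq_bigr do rewrite /wsqnorm mulr_sumr.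
rewrite exchange_big; apply: ler_sum => j _ /=.
under eq_bigr do rewrite mulrCA; rewrite -mulr_sumr ler_wpM2l //.
rewrite -lee_fin -aE; apply: ereal_sup_ubound; exists X => //.
by rewrite fsumEFin // fsbig_finite.
Qed.

(** The dual families may be infinite, even uncountable. The constraints make
all coordinate sums finite, and the primal inequality bounds the positive part
of each term of the objective. *)
Lemma weak_duality A l mu nu : primal_feasible A l -> dual_feasible mu nu ->
  dual_obj A mu nu <= primal_obj l.
Proof.
move=> fl [mu0 nu0 h]; have l0 : forall j, 0 <= l 0 j by case: fl.
pose a j := fine (\esum_(xi in usphere) (mu xi * cabs (xi j 0) ^+ 2)%:E).
pose b j := fine (\esum_(xi in usphere) (nu xi * cabs (xi j 0) ^+ 2)%:E).
have ab j : [/\ \esum_(xi in usphere) (mu xi * cabs (xi j 0) ^+ 2)%:E = (a j)%:E,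
    \esum_(xi in usphere) (nu xi * cabs (xi j 0) ^+ 2)%:E = (b j)%:E
    & a j + b j <= 1].
  have pos m : (forall xi, usphere xi -> 0 <= m xi) ->
      (0 <= \esum_(xi in usphere) (m xi * cabs (xi j 0) ^+ 2)%:E)%E.
    by move=> m0; apply: esum_ge0 => x sx; rewrite lee_fin mulr_ge0 ?sqr_ge0 ?m0.
  rewrite /a /b; move: (h j) (pos _ mu0) (pos _ nu0).
  by case: (esum _ _) => [x||] //; case: (esum _ _) => [y||].
have ha : rsum usphere (fun xi => mu xi * qform A xi) <= \sum_j l 0 j * a j.
  apply/rsum_le/(esum_wsqnorm_le l0 mu0) => [x sx|j]; last by have [] := ab j.
  by rewrite ler_wpM2l ?mu0 //; have [] := feasible_qform x fl.
have hb : - rsum usphere (fun xi => nu xi * qform A xi) <= \sum_j l 0 j * b j.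
  rewrite rsumN.
  apply/rsum_le/(esum_wsqnorm_le l0 nu0) => [x sx|j]; last by have [] := ab j.
  by rewrite -mulrN ler_wpM2l ?nu0 //; have [] := feasible_qform x fl.
apply: le_trans (lerD ha hb) _; rewrite -big_split /=; apply: ler_sum => j _.
by rewrite -mulrDr ler_piMr //; have [] := ab j.
Qed.

Lemma dual_optimal_of_value A mu nu : A \is hermsymmx -> dual_feasible mu nu ->
  schur_dual_norm A <= dual_obj A mu nu -> dual_optimal A mu nu.
Proof.
move=> hA fmn le; split => // mu' nu' fmn'; apply: le_trans le.
by have [l fl <-] := primal_attained hA; apply: weak_duality.
Qed.

Lemma psd_pair_families A Q S : A \is hermsymmx -> pair_feasible Q S ->
  pair_value A Q S = schur_dual_norm A ->
  exists mu nu, [/\ finite_family mu nu, dual_optimal A mu nu,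
    dual_obj A mu nu = schur_dual_norm A, Q = proj_sum mu & S = proj_sum nu].
Proof.
move=> hA QS val; have [hQ hS _] := QS.
have [mu [mu0 fmu QE]] := psd_proj_sum_ex hQ.
have [nu [nu0 fnu SE]] := psd_proj_sum_ex hS.
have [feas obj] :=
  @finite_pair mu nu (conj fmu fnu) (fun x _ => mu0 x) (fun x _ => nu0 x).
have objE : dual_obj A mu nu = schur_dual_norm A by rewrite obj -QE -SE.
exists mu, nu; split => //; apply: dual_optimal_of_value => //.
  by apply/feas; rewrite -QE -SE.
by rewrite objE.
Qed.

Lemma herm_trace_real Y A : Y \is hermsymmx -> A \is hermsymmx ->
  \tr (Y *m A) = (Re (\tr (Y *m A)))%:C.
Proof.
move=> /hermsymmx_eq hY /hermsymmx_eq hA; apply/esym/RRe_real/CrealP.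
have -> : ((\tr (Y *m A))^*)%R = \tr ((Y *m A)^t*).
  by rewrite /mxtrace rmorph_sum; apply: eq_bigr => i _; rewrite [RHS]mxE [in RHS]mxE.
by rewrite trmx_mul map_mxM /= hY hA mxtrace_mulC.
Qed.

(** A factorisation through [Delta d] bounds the quadratic form of [A] at [v] by
[opnorm B] times the squared norm of [Delta d *m v]. *)
Lemma scaled_sqr_feasible A B d : A = Delta d *m B *m Delta d ->
  primal_feasible A (\row_j (opnorm B * d 0 j ^+ 2)).
Proof.
move=> AE; have bound v : cabs (cdot (A *m v) v)
    <= \sum_j (\row_j (opnorm B * d 0 j ^+ 2)) 0 j * cabs (v j 0) ^+ 2.
  rewrite AE -!mulmxA cdot_Delta; apply: le_trans (opnorm_cdot _ _ _) _.
  rewrite -mulrA -expr2 l2norm_sqr mulr_sumr; apply: ler_sum => j _.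
  by rewrite DeltaE mxE cabsM cabsr exprMn real_normK ?num_real // mulrA.
split => [j|v _|v _].
- by rewrite mxE mulr_ge0 ?opnorm_ge0 ?sqr_ge0.
- by apply: le_trans (bound v); apply: Re_le_cabs.
- by apply: le_trans (bound v); rewrite -cabsN -ReN; apply: Re_le_cabs.
Qed.

Lemma primal_obj_scaled_sqr c d : \sum_j d 0 j ^+ 2 = 1 ->
  primal_obj (\row_j (c * d 0 j ^+ 2)) = c.
Proof.
move=> d1; rewrite /primal_obj; under eq_bigr do rewrite mxE.
by rewrite -mulr_sumr d1 mulr1.
Qed.

(** A feasible vector with sum 0 vanishes, and it factors [A]. *)
Lemma schur_dual_norm_gt0 A : A != 0 -> A \is hermsymmx ->
  0 < schur_dual_norm A.
Proof.
move=> A0 hA; have [l fl <-] := primal_attained hA.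
have l0 : forall j, 0 <= l 0 j by case: fl.
rewrite lt_neqAle sumr_ge0 // andbT eq_sym; apply: contra A0.
rewrite psumr_eq0 // => /allP lz.
have [B [_ -> _ _]] := feasible_factorization hA fl.
apply/eqP/matrixP => i j; rewrite Delta_sandwich !mxE.
by have /eqP -> := lz j (mem_index_enum j); rewrite sqrtr0 mulr0.
Qed.

(** An optimal primal vector is, up to the factor [schur_dual_norm A], the vector
of squares of [xi]. The norm of [B] cannot be smaller, since the squares scaled
by it are feasible again. *)
Lemma cbB_exists A : A != 0 -> A \is hermsymmx ->
  exists (xi : 'rV[R]_n) B, cbB_factorization A xi B.
Proof.
move=> A0 hA; have N0 := schur_dual_norm_gt0 A0 hA.
have [l fl lN] := primal_attained hA.
have l0 : forall j, 0 <= l 0 j by case: fl.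
have [B [hB AE B1 Bker]] := feasible_factorization hA fl.
set N := schur_dual_norm A in N0 lN *.
pose xi : 'rV[R]_n := \row_j Num.sqrt (l 0 j / N).
have xi2 j : xi 0 j ^+ 2 = l 0 j / N.
  by rewrite mxE sqr_sqrtr // divr_ge0 // ltW.
have xi1 : \sum_j xi 0 j ^+ 2 = 1.
  under eq_bigr do rewrite xi2.
  by rewrite -mulr_suml [\sum_j _]lN divff // gt_eqF.
have AE' : A = Delta xi *m (N%:C *: B) *m Delta xi.
  rewrite {1}AE; apply/matrixP => i j; rewrite !Delta_sandwich !mxE.
  have sE k : Num.sqrt (l 0 k) = Num.sqrt N * Num.sqrt (l 0 k / N).
    by rewrite -sqrtrM ?ltW // mulrCA mulfV ?mulr1 // gt_eqF.
  have NE : N%:C = (Num.sqrt N)%:C * (Num.sqrt N)%:C :> C.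
    by rewrite -rmorphM /= -expr2 sqr_sqrtr // ltW.
  rewrite !sE NE !rmorphM /=.
  by ring.
have hB' : N%:C *: B \is hermsymmx.
  rewrite hermsymmxE; apply/eqP/matrixP => i j; rewrite -{1}(hermsymmx_eq hB).
  by rewrite !mxE rmorphM /= conjr.
exists xi, (N%:C *: B); split => //.
- by split => // j; rewrite mxE sqrtr_ge0.
- apply/eqP; rewrite eq_le; apply/andP; split.
    apply: opnorm_le => [|u v]; first exact: ltW.
    apply: le_trans (Re_le_cabs _) _; rewrite -scalemxAl cdotZl cabsM cabsr.
    rewrite gtr0_norm // -!mulrA ler_pM2l //; apply: le_trans (opnorm_cdot _ _ _) _.
    by rewrite -mulrA ler_piMl // mulr_ge0 ?l2norm_ge0.
  have := dual_norm_le_primal hA (scaled_sqr_feasible AE').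
  by rewrite primal_obj_scaled_sqr.
- move=> v xiv; have Bv : (N%:C *: B) *m v = 0.
    apply/matrixP => i k; rewrite ord1 !mxE big1 // => j _.
    have : (xi 0 j)%:C * v j 0 = 0 by rewrite -DeltaE xiv mxE.
    move=> /eqP; rewrite mulf_eq0 => /orP[/eqP xj0|/eqP ->]; last by rewrite mulr0.
    have xj : xi 0 j = 0 by have := congr1 (@complex.Re R) xj0.
    have lj : l 0 j = 0.
      have := xi2 j; rewrite xj expr0n /= => /esym/eqP.
      by rewrite mulf_eq0 invr_eq0 [N == 0]gt_eqF // orbF => /eqP.
    by rewrite mxE Bker // mulr0 mul0r.
  by rewrite (hermsymmx_eq hB').
Qed.

End Families.

(** * Optimality of both programs *)

Theorem theorem6p4 (R : realType) (n : nat) (A : 'M[R[i]]_n)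
    (A_neq0 : A != 0) (A_sa : A \is hermsymmx) :
  [/\ [/\ primal_value A (schur_dual_norm A),
          dual_value A (schur_dual_norm A),
          exists xi B, cbB_factorization A xi B
        & forall xi B, cbB_factorization A xi B ->
            primal_optimal A (\row_(j < n) (schur_dual_norm A * xi 0 j ^+ 2))],
      forall Y : 'M[R[i]]_n, Y \is hermsymmx ->
        schur_norm Y = 1 -> \tr (Y *m A) = (schur_dual_norm A)%:C ->
        forall Q S : 'M[R[i]]_n, psd Q -> psd S -> Y = Q - S ->
          schur_norm Y = schur_norm (Q + S) ->
          exists mu nu,
            [/\ finite_family mu nu, dual_optimal A mu nu,
                Q = proj_sum mu & S = proj_sum nu]
    & forall mu nu : 'cV[R[i]]_n -> R,
        finite_family mu nu -> dual_optimal A mu nu ->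
        schur_norm (proj_sum mu - proj_sum nu) = 1 /\
        \tr ((proj_sum mu - proj_sum nu) *m A) = (schur_dual_norm A)%:C].
Proof.
split; first split.
- have [l fl lN] := primal_attained A_sa; exists l => //; split => // l' fl'.
  by rewrite lN; apply: dual_norm_le_primal.
- have [Q [S [QS val]]] := dual_pair_attained A_sa.
  have [mu [nu [_ opt obj _ _]]] := psd_pair_families A_sa QS val.
  by exists mu, nu.
- exact: cbB_exists.
- move=> xi B [[xi1 xi0] _ AE BN _].
  split; first by rewrite -BN; apply: scaled_sqr_feasible.
  by move=> l' fl'; rewrite primal_obj_scaled_sqr //; apply: dual_norm_le_primal.
- move=> Y _ Y1 trY Q S hQ hS YE YQS.
  have QS : pair_feasible Q S.
    split; [exact: hQ|exact: hS|move=> j].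
    have dj : complex.Re (Q j j) + complex.Re (S j j) <= cabs ((Q + S) j j).
      by rewrite -ReD; have := Re_le_cabs ((Q + S) j j); rewrite [(Q + S) j j]mxE.
    apply: le_trans dj _.
    apply: le_trans (cabs_entry_schur (Q + S) j j) _.
    rewrite -YQS.
    by rewrite Y1.
  have val : pair_value A Q S = schur_dual_norm A.
    by rewrite /pair_value -YE trY.
  have [mu [nu [fin opt _ QE SE]]] := psd_pair_families A_sa QS val.
  by exists mu, nu; split; [exact: fin|exact: opt|exact: QE|exact: SE].
(* The value is the trace, and pairing [Y] with a primal optimum shows that a
   Schur norm below 1 could not reach it. *)
- move=> mu nu fin opt; have [[mu0 nu0 _] _] := opt.
  have [feas obj] := finite_pair fin mu0 nu0.
  have [fmn omn] := opt; have QS := (feas.1 fmn).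
  set Y := proj_sum mu - proj_sum nu; have hY : Y \is hermsymmx.
    have [/psd_herm hQ /psd_herm hS _] := QS.
    rewrite hermsymmxE /Y linearB /= map_mxB.
    by rewrite !hermsymmx_eq.
  have val : complex.Re (\tr (Y *m A)) = schur_dual_norm A.
    have [Q' [S' [QS' val']]] := dual_pair_attained A_sa.
    have [mu' [nu' [_ [fmn' _] obj' _ _]]] := psd_pair_families A_sa QS' val'.
    apply/eqP; rewrite eq_le (pair_value_le A QS) -obj'.
    by have := omn _ _ fmn'; rewrite obj.
  split; last by rewrite herm_trace_real // val.
  apply/eqP; rewrite eq_le pair_schur_norm //=.
  have [l fl lN] := primal_attained A_sa.
  have := feasible_trace Y A_sa fl; rewrite (hermsymmx_eq hY) lN => le.
  have := le_trans (Re_le_cabs _) le; rewrite val.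
  by rewrite ler_pMl // schur_dual_norm_gt0.
Qed.
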